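(* Let $k$ be an algebraically closed field. (1) (Type A) Suppose $\operatorname{char}k=0$, let $T = k[x_1, x_2^{\pm 1}, \dots, x_d^{\pm 1}]$ with $k$-automorphism $\sigma(x_1) = x_1 + 1$, $\sigma(x_i) = p_i x_i$ for $i \geq 2$, where $p_2,\dots,p_d\in k^\times$ freely generate a free abelian subgroup of $k^\times$. Let $X=\operatorname{Spec}T$, let $0\ne f\in T$ be a non-unit, and let $Z=V(f)\subseteq X$ be the vanishing set of $f$. Then $Z$ is $\sigma$-lonely if and only if (after replacing $f$ by a unit multiple) we have either (i) $f \in k[x_1]$ and no two distinct roots of $f$ differ by an integer; or else (ii) there is $z = x_2^{i_2} \cdots x_d^{i_d}$ for some $i_j \in \mathbb{Z}$ such that $f \in k[z, z^{-1}]$ and no two distinct roots of $f$ (as a polynomial in $z$) have ratio which is a power $\rho^i$ of $\rho = p_2^{i_2} \cdots p_d^{i_d}$ for some $i \in \mathbb{Z}$. (2) (Type B) Let $k$ have arbitrary characteristic and let $T = k[x_2^{\pm 1}, \dots, x_d^{\pm 1}]$ with $k$-automorphism $\sigma(x_i)=p_ix_i$ for all $i$, where $p_2,\dots,p_d\in k^\times$ freely generate a free abelian subgroup of $k^\times$. Let $X=\operatorname{Spec}T$ and let $0\neq f\in T$ be a non-unit. Then $Z = V(f)$ is $\sigma$-lonely if and only if (after replacing $f$ by a unit multiple) condition (ii) of part (1) holds: there is $z = x_2^{i_2} \cdots x_d^{i_d}$ with $i_j\in\mathbb{Z}$ such that $f\in k[z,z^{-1}]$ and no two distinct roots of $f$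 (as a polynomial in $z$) have ratio $\rho^i$ for some $i\in\mathbb{Z}$, where $\rho=p_2^{i_2}\cdots p_d^{i_d}$.
   Context: The automorphism of $X=\operatorname{Spec}T$ induced by $\sigma:T\to T$ is also denoted $\sigma$: $\sigma(\mathfrak p)=\sigma^{-1}(\mathfrak p)$ (preimage). A closed subset $Z\subseteq X$ is $\sigma$-lonely if $Z\cap\sigma^i(Z)=\emptyset$ for all $0\ne i\in\mathbb{Z}$. In (ii), the roots of $f$ are its zeros in $k^\times$ as a Laurent polynomial in $z$. *)

(* Defs.v *)
From HB Require Import structures.
From mathcomp Require Import all_boot all_order all_algebra.
From mathcomp Require Import finmap monalg.
From mathcomp Require Import boolp classical_sets.

Set Implicit Arguments.
Unset Strict Implicit.
Unset Printing Implicit Defensive.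

Import GRing.Theory.

Local Open Scope fset_scope.
Local Open Scope ring_scope.

(* [monoid_alg R G] is the monoid algebra R[G] of a commutative monoid G,       *)
(* written additively: the basis monomial of exponent e is << e >>, and         *)
(* << e1 >> * << e2 >> = << e1 + e2 >>. The ring structure that monalg puts on  *)
(* {malg R[G]} is only available for exponent monoids without invertible        *)
(* elements, which excludes Laurent monomials, so we rebuild it on this copy.   *)
Definition monoid_alg (R : comNzRingType) (G : nmodType) : Type := {malg R[G]}.

HB.instance Definition _ (R : comNzRingType) (G : nmodType) :=
  GRing.Lmodule.copy (monoid_alg R G) {malg R[G]}.

Section MonoidAlg.
Context (R : comNzRingType) (G : nmodType).
Local Notation T := {malg R[G]}.
Implicit Types (g : T) (a b : G).

Definition ma_one : T := << 1 *g 0 >>.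

Definition ma_mul g1 g2 : T :=
  \sum_(a <- msupp g1) \sum_(b <- msupp g2) << g1@_a * g2@_b *g (a + b)%R >>.

Lemma ma_mulw (d1 d2 : {fset G}) g1 g2 :
  msupp g1 `<=` d1 -> msupp g2 `<=` d2 ->
  ma_mul g1 g2 =
    \sum_(a <- d1) \sum_(b <- d2) << g1@_a * g2@_b *g (a + b)%R >>.
Proof.
move=> le_d1 le_d2; rewrite /ma_mul (big_fset_incl _ le_d1) /=.
  apply/eq_bigr=> a _; apply/big_fset_incl => // b _ /mcoeff_outdom ->.
  by rewrite mulr0 monalgU0.
move=> a _ /mcoeff_outdom g1a.
by rewrite big1 // => b _; rewrite g1a mul0r monalgU0.
Qed.

Lemma ma_mulC : commutative ma_mul.
Proof.
move=> g1 g2; rewrite /ma_mul exchange_big /=; apply/eq_bigr => b _.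
by apply/eq_bigr => a _; rewrite mulrC addrC.
Qed.

Lemma ma_mul0 g : ma_mul 0 g = 0.
Proof. by rewrite /ma_mul msupp0 big_seq_fset0. Qed.

Lemma ma_mulUU c1 c2 a b :
  ma_mul << c1 *g a >> << c2 *g b >> = << c1 * c2 *g (a + b)%R >>.
Proof. by rewrite (ma_mulw msuppU_le msuppU_le) !big_seq_fset1 !mcoeffUU. Qed.

Lemma ma_mulUg c a g :
  ma_mul << c *g a >> g = \sum_(b <- msupp g) << c * g@_b *g (a + b)%R >>.
Proof.
rewrite (ma_mulw msuppU_le (fsubset_refl _)) big_seq_fset1.
by apply/eq_bigr => b _; rewrite mcoeffUU.
Qed.

Lemma ma_mul1 : left_id ma_one ma_mul.
Proof.
move=> g; rewrite ma_mulUg [RHS]monalgE.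
by apply/eq_bigr => b _; rewrite mul1r add0r.
Qed.

Lemma ma_mulDl : left_distributive ma_mul +%R.
Proof.
move=> g1 g2 g; have s := fsubset_refl (msupp g).
rewrite (ma_mulw (msuppD_le g1 g2) s) (ma_mulw (fsubsetUl (msupp g1) (msupp g2)) s).
rewrite (ma_mulw (fsubsetUr (msupp g1) (msupp g2)) s) -big_split /=; apply/eq_bigr=> a _.
rewrite -big_split /=; apply/eq_bigr=> b _.
by rewrite mcoeffD mulrDl monalgUD.
Qed.

Lemma ma_mulDr : right_distributive ma_mul +%R.
Proof. by move=> g g1 g2; rewrite ma_mulC ma_mulDl !(ma_mulC _ g). Qed.

Lemma ma_mul_suml I (r : seq I) (F : I -> T) g :
  ma_mul (\sum_(i <- r) F i) g = \sum_(i <- r) ma_mul (F i) g.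
Proof.
exact: (big_morph (ma_mul^~ g) (fun _ _ => ma_mulDl _ _ _) (ma_mul0 g)).
Qed.

Lemma ma_mul_sumr I (r : seq I) (F : I -> T) g :
  ma_mul g (\sum_(i <- r) F i) = \sum_(i <- r) ma_mul g (F i).
Proof.
by rewrite ma_mulC ma_mul_suml; apply/eq_bigr => i _; rewrite ma_mulC.
Qed.

Lemma ma_mulA : associative ma_mul.
Proof.
move=> g1 g2 g3; rewrite [g1]monalgE !ma_mul_suml; apply/eq_bigr => a _.
rewrite [g2]monalgE ma_mul_sumr !ma_mul_suml ma_mul_sumr; apply/eq_bigr => b _.
rewrite [g3]monalgE !ma_mul_sumr; apply/eq_bigr => c _.
by rewrite !ma_mulUU mulrA addrA.
Qed.

Lemma ma_one_neq0 : ma_one != 0.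
Proof. by rewrite /ma_one monalgU_eq0 oner_eq0. Qed.

Lemma ma_scaleAl (c : R) g1 g2 : c *: ma_mul g1 g2 = ma_mul (c *: g1) g2.
Proof.
have scaleE g : c *: g = ma_mul << c *g 0 >> g.
  by rewrite malgZ_def ma_mulUg; apply/eq_bigr => a _; rewrite add0r.
by rewrite !scaleE ma_mulA.
Qed.

HB.instance Definition _ := GRing.Zmodule_isComNzRing.Build (monoid_alg R G)
  ma_mulA ma_mulC ma_mul1 ma_mulDl ma_one_neq0.
HB.instance Definition _ :=
  GRing.Lmodule_isLalgebra.Build R (monoid_alg R G) ma_scaleAl.
HB.instance Definition _ := GRing.Lalgebra_isComAlgebra.Build R (monoid_alg R G).

End MonoidAlg.

(* The units are the invertible elements; invertibility is decided classically. *)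
Section MonoidAlgUnit.
Context (R : comNzRingType) (G : nmodType).
Local Notation T := (monoid_alg R G).

Definition ma_unit : pred T := fun x => `[< exists y, y * x = 1 >].

Definition ma_inv (x : T) : T :=
  if pselect (exists y, y * x = 1) is left h then sval (cid h) else x.

Lemma ma_mulVr : {in ma_unit, left_inverse 1 ma_inv *%R}.
Proof.
move=> x /asboolP ux; rewrite /ma_inv.
by case: pselect => // h; case: cid.
Qed.

Lemma ma_unitPl (x y : T) : y * x = 1 -> ma_unit x.
Proof. by move=> yx; apply/asboolP; exists y. Qed.

Lemma ma_inv_out : {in [predC ma_unit], ma_inv =1 id}.
Proof. by move=> x /asboolP nx; rewrite /ma_inv; case: pselect. Qed.

HB.instance Definition _ := GRing.ComNzRing_hasMulInverse.Build (monoid_alg R G)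
  ma_mulVr ma_unitPl ma_inv_out.

End MonoidAlgUnit.

(* k[z, z^-1], and the evaluation of a Laurent polynomial at a unit a of a ring *)
(* A along phi : k -> A.                                                        *)
Definition laurent1 (k : comNzRingType) := monoid_alg k int.

Definition laurent_eval (k : comNzRingType) (A : unitRingType) (phi : k -> A)
    (a : A) (g : laurent1 k) : A :=
  \sum_(j <- msupp (g : {malg k[int]})) phi (g : {malg k[int]})@_j * a ^ j.

(* In both rings below the index i : 'I_n stands for i + 2, so that n = d - 1.  *)

(* Type B ring: k[x_2^{+-1}, ..., x_d^{+-1}]. *)
Definition ringB (k : comNzRingType) (n : nat) := monoid_alg k 'rV[int]_n.

Definition varB (k : comNzRingType) (n : nat) (i : 'I_n) : ringB k n :=
  << delta_mx 0 i : 'rV[int]_n >>.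

(* Type A ring: k[x_1, x_2^{+-1}, ..., x_d^{+-1}]; x_1 is varA1. *)
Definition ringA (k : comNzRingType) (n : nat) :=
  monoid_alg k (nat * 'rV[int]_n)%type.

Definition varA1 (k : comNzRingType) (n : nat) : ringA k n :=
  << (1%N, 0) : nat * 'rV[int]_n >>.

Definition varA (k : comNzRingType) (n : nat) (i : 'I_n) : ringA k n :=
  << (0%N, delta_mx 0 i) : nat * 'rV[int]_n >>.

(* The points of Spec R. The membership predicates of [prime_idealr] are        *)
(* boolean; classically these are all the prime ideals.                         *)
Definition spec (R : comNzRingType) : Type := prime_idealr R.

Section SpecMap.
Context (R S : comNzRingType) (s : {rmorphism R -> S}) (P : prime_idealr S).

Definition comap : {pred R} := fun a => s a \in P.

Lemma mem_comap a : (a \in comap) = (s a \in P).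
Proof. by []. Qed.

Lemma comap_idealr : idealr_closed comap.
Proof.
split=> [||a u v]; rewrite !mem_comap ?rmorph0 ?rmorph1 ?idealr0 ?idealr1 //.
by rewrite rmorphD rmorphM => su sv; rewrite rpredD // idealMr.
Qed.

Lemma comap_prime : prime_idealr_closed comap.
Proof. by move=> u v; rewrite !mem_comap rmorphM prime_idealrM. Qed.

HB.instance Definition _ := isIdealr.Build R comap comap_idealr.
HB.instance Definition _ := isPrimeIdealrClosed.Build R comap comap_prime.

Definition spec_map : spec R := PrimeIdealr.clone R comap _.

End SpecMap.

Local Open Scope classical_set_scope.

Definition vanishing_set (R : comNzRingType) (f : R) : set (spec R) :=
  [set P | f \in P].

(* s^i(Z) for a bijection s and i : int. *)
Definition zimage (X : Type) (s : X -> X) (i : int) (Z : set X) : set X :=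
  match i with
  | Posz m => iter m s @` Z
  | Negz m => iter m.+1 s @^-1` Z
  end.

Definition lonely (X : Type) (s : X -> X) (Z : set X) : Prop :=
  forall i : int, i != 0 -> Z `&` zimage s i Z = set0.

(* p_2, ..., p_d are a basis of the subgroup of k^* that they generate. *)
Definition freely_generate (k : fieldType) (n : nat) (p : 'I_n -> k) : Prop :=
  forall e : 'I_n -> int, \prod_(i < n) p i ^ e i = 1 -> forall i, e i = 0.

Definition conditionI (k : fieldType) (A : algType k) (x1 f : A) : Prop :=
  exists g : {poly k},
    f = horner_alg x1 g /\
    forall a b : k, root g a -> root g b -> a != b ->
      forall m : int, a - b != m%:~R.

Definition conditionII (k : fieldType) (A : comUnitAlgType k) (n : nat)
    (x : 'I_n -> A) (p : 'I_n -> k) (f : A) : Prop :=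
  exists e : 'I_n -> int,
    let z := \prod_(i < n) x i ^ e i in
    let rho := \prod_(i < n) p i ^ e i in
    exists g : laurent1 k,
      f = laurent_eval (in_alg A) z g /\
      forall a b : k, a != 0 -> b != 0 ->
        laurent_eval idfun a g = 0 -> laurent_eval idfun b g = 0 -> a != b ->
        forall m : int, a / b != rho ^ m.

(* Main.v *)
(* Write f = sum_m c_m(x_1) x^m over exponents m in Z^(d-1), and restrict it to
   the curves y |-> a^w y^v, with v separating the exponents of f and w arbitrary:
   this gives a polynomial P_{b,a}(y) at x_1 = b, whose extreme coefficients come
   from single monomials m0 and m1. If the zero set of f is lonely, the resultant
   in y of P_{b,a} and of its translate by the group element (tau, t) vanishes for
   no (b, a) when (tau, t) = (i, p^i) with i large, so it is then independent of b
   and a monomial in a. Both are identities between exponential polynomials in i,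
   hence hold for all (tau, t). At tau = 0, t = q^v this says that the ratios of
   the roots of P_{b,a} lie in a finite set independent of (b, a). Hence so do the
   normalised coefficients of P_{b,a}, and these therefore do not vary with b or a:
   every c_m is constant and the exponents of f lie on a line, unless f has a
   single exponent. The converse is Bezout's identity in k[X].                   *)

Require Import Defs.
From HB Require Import structures.
From mathcomp Require Import all_boot all_order all_algebra.
From mathcomp Require Import finmap monalg.
From mathcomp Require Import boolp classical_sets zify.

Set Implicit Arguments.
Unset Strict Implicit.
Unset Printing Implicit Defensive.

Import Order.TTheory GRing.Theory Num.Theory.

Local Open Scope ring_scope.

(** * Polynomials and formal resultants over a closed field *)

Section ClosedPoly.
Variable k : closedFieldType.
Implicit Types (P Q : {poly k}) (M : nat).

Lemma no_root_size1 P : (forall x, ~~ root P x) -> size P = 1%N.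
Proof.
move=> noP; apply/eqP; apply: contraT => /closed_rootP[x Px].
by have := noP x; rewrite Px.
Qed.

Lemma coprimep_no_common_root P Q :
  (P != 0) || (Q != 0) -> (forall x, root P x -> ~~ root Q x) -> coprimep P Q.
Proof.
move=> PQ0 noPQ; rewrite /coprimep; apply: contraT => /closed_rootP[x].
by rewrite root_gcd => /andP[Px]; rewrite (negbTE (noPQ x Px)).
Qed.

Lemma exists_notin (s : seq k) : exists x, x \notin s.
Proof.
have /closed_nonrootP[x] : \prod_(a <- s) ('X - a%:P) != 0.
  by rewrite monic_neq0 // monic_prod_XsubC.
by rewrite root_prod_XsubC => xs; exists x.
Qed.

Lemma poly_eval_inj P Q : (forall x, P.[x] = Q.[x]) -> P = Q.
Proof.
move=> PQ; apply/eqP; rewrite -subr_eq0; apply: contraT => /closed_nonrootP[x].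
by rewrite /root !hornerE PQ subrr eqxx.
Qed.

(** The product of the [P - c] over [c] in [K] vanishes everywhere, so one factor is zero. *)
Lemma size_finite_values P (K : seq k) :
  (forall x, P.[x] \in K) -> (size P <= 1)%N.
Proof.
move=> PK; have : \prod_(c <- K) (P - c%:P) = 0.
  apply: poly_eval_inj => x; rewrite horner0 horner_prod; apply/eqP.
  rewrite prodf_seq_eq0; apply/hasP; exists P.[x] => //=.
  by rewrite !hornerE subrr.
move/eqP; rewrite prodf_seq_eq0 => /hasP[c _] /=.
by rewrite subr_eq0 => /eqP ->; rewrite size_polyC leq_b1.
Qed.

Lemma expz_finite_values (E : int) (K : seq k) :
  (forall x : k, x != 0 -> x ^ E \in K) -> E = 0.
Proof.
have nat_case (j : nat) (K' : seq k) :
    (forall x : k, x != 0 -> x ^+ j \in K') -> j = 0%N.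
  (* The extra values 0 and 1 account for [x = 0]. *)
  move=> xK; have /size_finite_values : forall x, ('X^j).[x] \in 0 :: 1 :: K'.
    move=> x; rewrite hornerXn; have [->|/xK x0] := eqVneq x 0.
      by rewrite expr0n; case: (j == 0)%N; rewrite !inE eqxx ?orbT.
    by rewrite !inE x0 !orbT.
  by rewrite size_polyXn ltnS leqn0 => /eqP.
case: E => j xK; first by rewrite (nat_case _ _ xK).
suff : j.+1 = 0%N by [].
apply: (nat_case _ K) => x x0.
by have := xK x^-1; rewrite invr_eq0 => /(_ x0); rewrite exprz_inv NegzE opprK.
Qed.

Lemma exists_expz_root (E : int) (a : k) :
  E != 0 -> a != 0 -> exists2 x : k, x != 0 & x ^ E = a.
Proof.
have nat_case (j : nat) (b : k) :
    (0 < j)%N -> b != 0 -> exists2 x : k, x != 0 & x ^+ j = b.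
  move=> j0 b0; have /closed_rootP[x] : size ('X^j - b%:P) != 1%N.
    by rewrite size_XnsubC //; case: j j0.
  rewrite /root !hornerE subr_eq0 => /eqP xj; exists x => //.
  by apply: contra_neq b0 => x0; rewrite -xj x0 expr0n eqn0Ngt j0.
case: E => j E0 a0; first by apply: nat_case => //; rewrite lt0n.
have [|x x0 xj] := @nat_case j.+1 a^-1 isT; first by rewrite invr_eq0.
by exists x => //; rewrite -[a]invrK -xj.
Qed.

(* Both polynomials get the formal degree [M], since leading coefficients vanish *)
(* at some parameters, where the size of [Sylvester_mx] would jump.             *)
Definition sylvester M P Q : 'M[k]_(M + M) :=
  \matrix_(i, j) match split i with
                 | inl i1 => (P * 'X^i1)`_j
                 | inr i2 => (Q * 'X^i2)`_j
                 end.

(** The powers of [x] form a nonzero kernel vector: each row applied to them evaluates a multiple of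
    [P] or [Q] at [x]. *)
Lemma det_sylvester_root M P Q x :
  (0 < M)%N -> (size P <= M.+1)%N -> (size Q <= M.+1)%N ->
  root P x -> root Q x -> \det (sylvester M P Q) = 0.
Proof.
move=> M0 sP sQ /rootP Px /rootP Qx; rewrite -det_tr; apply/eqP/det0P.
exists (\row_j x ^+ j).
  apply/eqP => /rowP /(_ (Ordinal (leq_trans M0 (leq_addr M M)))).
  by rewrite !mxE /= expr0 => /eqP; rewrite oner_eq0.
apply/rowP => i; rewrite !mxE.
have eval (R : {poly k}) (l : 'I_M) : (size R <= M.+1)%N ->
    \sum_(j < M + M) x ^+ j * (R * 'X^l)`_j = (R * 'X^l).[x].
  move=> sR; rewrite (@horner_coef_wide _ (M + M)).
    by apply: eq_bigr => j _; rewrite mulrC.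
  apply: leq_trans (size_polyMleq _ _) _; rewrite size_polyXn.
  by have := ltn_ord l; lia.
under eq_bigr => j _ do rewrite !mxE.
by case: (split i) => l; rewrite eval // !hornerE ?Px ?Qx mul0r.
Qed.

(** Both formal leading coefficients vanish, so the last column is zero. *)
Lemma det_sylvester_lead M P Q :
  (0 < M)%N -> (size P <= M)%N -> (size Q <= M)%N ->
  \det (sylvester M P Q) = 0.
Proof.
move=> M0 sP sQ; rewrite -det_tr; apply/eqP/det0P.
have lM : ((M + M).-1 < M + M)%N by lia.
exists (delta_mx 0 (Ordinal lM)).
  apply/eqP => /rowP /(_ (Ordinal lM)).
  by rewrite !mxE !eqxx => /eqP; rewrite oner_eq0.
apply/rowP => i; have := rowE (Ordinal lM) (sylvester M P Q)^T.
move=> <-; rewrite !mxE.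
have le_l (l : 'I_M) : (M <= (M + M).-1 - l)%N by have := ltn_ord l; lia.
by case: (split i) => l; rewrite coefMXn nth_default ?if_same //= (leq_trans _ (le_l l)).
Qed.

(** A left kernel vector gives [U * P + V * Q = 0] with cofactors of size at most [M]. Whichever of
    [P] and [Q] has exact degree [M] is coprime to the other, so it divides a cofactor that is too
    small for it unless zero. *)
Lemma det_sylvester_neq0 M P Q :
  (size P <= M.+1)%N -> (size Q <= M.+1)%N ->
  (M < size P)%N || (M < size Q)%N ->
  (forall x, root P x -> ~~ root Q x) -> \det (sylvester M P Q) != 0.
Proof.
move=> sP sQ lead noPQ; apply/negP => /det0P[u u0 uS].
pose U := \poly_(i < M) (if insub i is Some l then u 0 (lshift M l) else 0).
pose V := \poly_(i < M) (if insub i is Some l then u 0 (rshift M l) else 0).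
have sumE (R : {poly k}) (a : 'I_M -> k) (j : nat) :
    (\poly_(i < M) (if insub i is Some l then a l else 0) * R)`_j =
    \sum_(l < M) a l * (R * 'X^l)`_j.
  rewrite poly_def mulr_suml coef_sum; apply: eq_bigr => l _.
  by rewrite valK -scalerAl coefZ ['X^l * R]mulrC.
have UV : U * P + V * Q = 0.
  apply/polyP => j; rewrite coefD coef0 !sumE.
  have [ltj|lej] := ltnP j (M + M); last first.
    have le_l (l : 'I_M) : (M.+1 <= j - l)%N by have := ltn_ord l; lia.
    by rewrite !big1 ?addr0 // => l _; rewrite coefMXn nth_default ?if_same ?mulr0 //
      (leq_trans _ (le_l l)).
  have := congr1 (fun A : 'rV_(M + M) => A 0 (Ordinal ltj)) uS.
  rewrite !mxE big_split_ord /= => uSj; rewrite -[RHS]uSj; congr (_ + _).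
    apply: eq_bigr => l _.
    by rewrite !mxE (unsplitK (inl l)).
  by apply: eq_bigr => l _; rewrite !mxE (unsplitK (inr l)).
have cPQ : coprimep P Q.
  apply: coprimep_no_common_root => //.
  by case/orP: lead => H; rewrite -!size_poly_gt0 (leq_ltn_trans _ H) ?orbT.
have [sU sV] : (size U <= M)%N /\ (size V <= M)%N by split; apply: size_poly.
have UV0 : U = 0 /\ V = 0.
  case/orP: lead => H.
    have dV : P %| V.
      rewrite -(Gauss_dvdpl _ cPQ) -(dvdp_addr _ (dvdp_mulIr U P)) UV; exact: dvdp0.
    have V0 : V = 0.
      by apply: contraTeq dV => V0; apply/negP => /(dvdp_leq V0); rewrite leqNgt (leq_ltn_trans sV).
    split=> //; move/eqP: UV; rewrite V0 mul0r addr0 mulf_eq0 => /orP[/eqP//|/eqP P0].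
    by rewrite P0 size_poly0 in H.
  have dU : Q %| U.
    rewrite -(Gauss_dvdpl _ (_ : coprimep Q P)) 1?coprimep_sym //.
    by rewrite -(dvdp_addl _ (dvdp_mulIr V Q)) UV; exact: dvdp0.
  have U0 : U = 0.
    by apply: contraTeq dU => U0; apply/negP => /(dvdp_leq U0); rewrite leqNgt (leq_ltn_trans sU).
  split=> //; move/eqP: UV; rewrite U0 mul0r add0r mulf_eq0 => /orP[/eqP//|/eqP Q0].
  by rewrite Q0 size_poly0 in H.
case: UV0 => U0 V0; case/negP: u0; apply/eqP/rowP => i; rewrite mxE.
rewrite -[i]splitK; case: (split i) => l /=.
  by have := congr1 (fun R : {poly k} => R`_l) U0; rewrite coef_poly ltn_ord valK coef0.
by have := congr1 (fun R : {poly k} => R`_l) V0; rewrite coef_poly ltn_ord valK coef0.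
Qed.

Lemma coef_comp_scaleX P a i : (P \Po (a *: 'X))`_i = P`_i * a ^+ i.
Proof.
elim/poly_ind: P i => [|P c IH] i; first by rewrite comp_poly0 !coef0 mul0r.
rewrite comp_poly_MXaddC !coefD !coefC -scalerAr coefZ !coefMX IH.
by case: i => [|i] /=; rewrite ?mulr0 ?add0r ?expr0 ?mulr1 ?addr0 // exprS mulrCA.
Qed.

(* Writing the roots as [y * w_i] with the [w_i] in [Q], the coefficients are   *)
(* [P`_j = lead_coef P * y ^+ (M - j) * (coefficient of prod ('X - w_i))].      *)
Lemma coef_ratio_finite (Q : seq k) M : exists K : seq k, forall P,
  size P = M.+1 ->
  (forall x y, root P x -> root P y -> x != 0 /\ y / x \in Q) ->
  forall j, (j <= M)%N ->
  (P`_j / P`_M) ^+ M / (P`_0 / P`_M) ^+ (M - j) \in K.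
Proof.
pose c (w : seq k) j := (\prod_(a <- w) ('X - a%:P))`_j.
pose ratio (w : seq k) j := c w j ^+ M / c w 0%N ^+ (M - j).
(* The normalised roots form one of finitely many [M]-tuples over [Q]. *)
exists [seq ratio (map val (x.1 : M.-tuple (seq_sub Q))) (x.2 : 'I_M.+1) | x : _ * _].
move=> P sP rootP j jM.
have [s Ps] := closed_field_poly_normal P.
have P0 : P != 0 by rewrite -size_poly_gt0 sP.
have lc0 : lead_coef P != 0 by rewrite lead_coef_eq0.
have ss : size s = M.
  by apply/eqP; rewrite -eqSS -sP Ps size_scale // size_prod_XsubC.
have memsP x : x \in s -> root P x.
  by move=> xs; rewrite Ps rootZ // root_prod_XsubC.
(* Any root serves as [y]; if there is none, [y = 1]. *)
have [y [y0 sQ]] : exists y, y != 0 /\ forall x, x \in s -> x / y \in Q.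
  case: s {Ps ss} memsP => [|y s] memsP; first by exists 1; rewrite oner_neq0.
  have ys : root P y by apply: memsP; rewrite mem_head.
  exists y; split; first by have [] := rootP y y ys ys.
  by move=> x /memsP xs; have [] := rootP y x ys xs.
pose w := map (fun x => x / y) s.
have coefE i : (i <= M)%N -> P`_i = lead_coef P * y ^+ (M - i) * c w i.
  move=> iM; have yi0 : y ^+ i != 0 by rewrite expf_neq0.
  apply: (mulIf yi0); rewrite -coef_comp_scaleX.
  have -> : P \Po (y *: 'X) = (lead_coef P * y ^+ M) *: \prod_(a <- w) ('X - a%:P).
    rewrite {1}Ps comp_polyZ -scalerA; congr (_ *: _).
    rewrite rmorph_prod /= -ss big_map; elim: (s) => [|x r IH].
      by rewrite !big_nil scale1r.
    rewrite !big_cons IH exprS -scalerA scalerAr scalerAl; congr (_ * _).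
    rewrite rmorphB /= comp_polyX comp_polyC scalerBr; congr (_ - _).
    by rewrite -mul_polyC -rmorphM /= mulrC divfK.
  by rewrite coefZ -{1}(subnK iM) exprD /c -!mulrA [y ^+ i * _]mulrC.
have c0 : c w 0%N != 0.
  rewrite /c -horner_coef0 horner_prod prodf_seq_neq0; apply/allP => a /mapP[x xs ->] /=.
  rewrite !hornerE oppr_eq0 mulf_neq0 ?invr_eq0 //.
  by have [] := rootP x x (memsP x xs) (memsP x xs).
have cM : c w M = 1.
  have /monicP : \prod_(a <- w) ('X - a%:P) \is monic by exact: monic_prod_XsubC.
  rewrite lead_coefE size_prod_XsubC size_map ss //.
have quo i : (i <= M)%N -> P`_i / P`_M = y ^+ (M - i) * c w i.
  by move=> iM; rewrite !coefE // subnn cM expr0 !mulr1 -!mulrA mulrC -!mulrA mulVf ?mulr1.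
(* The exponents were chosen so that [y] cancels: it occurs to the power [(M - j) * M] above and
   [M * (M - j)] below. *)
have -> : (P`_j / P`_M) ^+ M / (P`_0 / P`_M) ^+ (M - j) = ratio w j.
  rewrite !quo // subn0 !exprMn -!exprM mulnC invfM mulrACA divff ?mul1r //.
  by rewrite expf_neq0.
have [t tw] : exists t : seq (seq_sub Q), map val t = w.
  have : all [in Q] w by apply/allP => a /mapP[x /sQ xs ->].
  elim: (w) => [|a r IH] /=; first by exists [::].
  by case/andP=> aQ /IH[t <-]; exists (SeqSub aQ :: t).
have st : size t == M by rewrite -(size_map val) tw size_map ss.
by apply/fintype.imageP; exists (Tuple st, Ordinal (jM : (j < M.+1)%N)); rewrite ?inE //= tw.
Qed.
End ClosedPoly.

(** * Function algebras and exponential polynomials *)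

Section FunctionAlgebra.
Variables (R : comNzRingType) (X : Type).

(** Closure under the ring operations is what puts the determinant of a matrix with entries in a
    class back into that class. It is applied to polynomials in [b], Laurent polynomials in [a] and
    exponential polynomials in [(tau, t)]. *)
Record function_algebra (C : (X -> R) -> Prop) : Prop := FunctionAlgebra {
  fa_ext : forall F G, F =1 G -> C F -> C G;
  fa_cst : forall c, C (fun=> c);
  fa_add : forall F G, C F -> C G -> C (fun x => F x + G x);
  fa_mul : forall F G, C F -> C G -> C (fun x => F x * G x) }.

Variables (C : (X -> R) -> Prop) (Calg : function_algebra C).

Lemma fa_sum I (r : seq I) (F : I -> X -> R) :
  (forall i, C (F i)) -> C (fun x => \sum_(i <- r) F i x).
Proof.
move=> CF; elim: r => [|i r IH].
  by apply: (fa_ext Calg) (fa_cst Calg 0) => x; rewrite big_nil.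
by apply: (fa_ext Calg) (fa_add Calg (CF i) IH) => x; rewrite big_cons.
Qed.

Lemma fa_prod I (r : seq I) (F : I -> X -> R) :
  (forall i, C (F i)) -> C (fun x => \prod_(i <- r) F i x).
Proof.
move=> CF; elim: r => [|i r IH].
  by apply: (fa_ext Calg) (fa_cst Calg 1) => x; rewrite big_nil.
by apply: (fa_ext Calg) (fa_mul Calg (CF i) IH) => x; rewrite big_cons.
Qed.

Lemma fa_det N (A : X -> 'M[R]_N) :
  (forall i j, C (fun x => A x i j)) -> C (fun x => \det (A x)).
Proof.
move=> CA; apply: fa_sum => s; apply: (fa_mul Calg) (fa_cst Calg _) _.
exact: fa_prod.
Qed.

End FunctionAlgebra.

Section Functions.
Variable k : fieldType.

Definition poly_fun (h : k -> k) := exists G : {poly k}, forall b, h b = G.[b].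

Definition laurent_fun (h : k -> k) :=
  exists (N : nat) (G : {poly k}), forall a, a != 0 -> h a = G.[a] / a ^+ N.

Lemma poly_fun_algebra : function_algebra poly_fun.
Proof.
split=> [F G FG [P FP]|c|F G [P FP] [Q GQ]|F G [P FP] [Q GQ]].
- by exists P => b; rewrite -FG.
- by exists c%:P => b; rewrite hornerC.
- by exists (P + Q) => b; rewrite hornerD FP GQ.
- by exists (P * Q) => b; rewrite hornerM FP GQ.
Qed.

Lemma laurent_fun_algebra : function_algebra laurent_fun.
Proof.
split=> [F G FG [N [P FP]]|c|F G [N [P FP]] [L [Q GQ]]|F G [N [P FP]] [L [Q GQ]]].
- by exists N, P => a; rewrite -FG; apply: FP.
- by exists 0%N, c%:P => a _; rewrite hornerC expr0 divr1.
- exists (N + L)%N, (P * 'X^L + Q * 'X^N) => a a0; rewrite FP // GQ // !hornerE exprD.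
  by rewrite addf_div ?expf_neq0.
- exists (N + L)%N, (P * Q) => a a0; rewrite FP // GQ // hornerM exprD.
  by rewrite mulf_div.
Qed.

Lemma laurent_fun_expz (E : int) : laurent_fun (fun a => a ^ E).
Proof.
case: E => j; first by exists 0%N, 'X^j => a _; rewrite hornerXn divr1.
by exists j.+1, 1 => a _; rewrite hornerC mul1r.
Qed.

End Functions.

Section ClosedFunctions.
Variable k : closedFieldType.

(** A polynomial without zeros over a closed field is constant. *)
Lemma poly_fun_neq0 (h : k -> k) :
  poly_fun h -> (forall b, h b != 0) -> forall b b', h b = h b'.
Proof.
move=> [G hG] h0 b b'; have /eqP/size_poly1P[c _ Gc] : size G = 1%N.
  by apply: no_root_size1 => x; rewrite /root -hG.
by rewrite !hG Gc !hornerC.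
Qed.

(** Without zeros off 0, [h] is a monomial [c * a ^ E]. The multiplicative form of this fact does
    not mention [c] or [E], so it can be carried over from special to general group elements. *)
Lemma laurent_fun_neq0 (h : k -> k) :
  laurent_fun h -> (forall a, a != 0 -> h a != 0) ->
  forall a b, a != 0 -> b != 0 -> h a * h b = h 1 * h (a * b).
Proof.
move=> [N [G hG]] h0; have [m [Q]] := multiplicity_XsubC G 0; rewrite polyC0 subr0.
have G0 : G != 0.
  by apply: contra_neq (h0 1 (oner_neq0 _)) => G0; rewrite hG ?oner_neq0 // G0 horner0 mul0r.
rewrite G0 /= => Q0 GE; have /eqP/size_poly1P[c _ Qc] : size Q = 1%N.
  apply: no_root_size1 => x; have [->//|x0] := eqVneq x 0.
  have := h0 x x0; rewrite hG // GE hornerM; apply: contra => /rootP ->.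
  by rewrite !mul0r.
have hE a : a != 0 -> h a = c * (a ^+ m / a ^+ N).
  by move=> a0; rewrite hG // GE Qc hornerM hornerC hornerXn mulrA.
move=> a b a0 b0; rewrite !hE ?oner_neq0 ?mulf_neq0 // !expr1n divr1 mulr1 !exprMn.
by rewrite -mulf_div mulrACA -mulrA.
Qed.

Lemma laurent_fun_zeros (h : k -> k) (a0 : k) :
  laurent_fun h -> a0 != 0 -> h a0 != 0 ->
  exists Q : seq k, forall a, a != 0 -> h a = 0 -> a \in Q.
Proof.
move=> [N [G hG]] a0_neq0; rewrite hG // mulf_eq0 negb_or => /andP[Ga0 _].
have [Q GQ] := closed_field_poly_normal G.
exists Q => a a_neq0 /eqP; rewrite hG // mulf_eq0 invr_eq0 (negbTE (expf_neq0 _ _)) //.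
rewrite orbF => /eqP/rootP; rewrite GQ rootZ ?root_prod_XsubC //.
by rewrite lead_coef_eq0; apply: contraNneq Ga0 => ->; rewrite horner0.
Qed.

End ClosedFunctions.

(** * Vanishing of exponential polynomials *)

Section ExponentialPolynomials.
Variable k : idomainType.

(** The shift preserves the leading term, which cancels in the difference. *)
Lemma size_shift_sub (g : {poly k}) :
  g != 0 -> (size (g \Po ('X + 1%:P) - g)%R < size g)%N.
Proof.
move=> g0; have s2 : size ('X + 1%:P : {poly k}) = 2 by rewrite size_XaddC.
have ss := size_comp_poly2 g s2.
rewrite -[X in (_ < X)%N]prednK ?size_poly_gt0 // ltnS; apply/leq_sizeP => j.
rewrite leq_eqVlt => /orP[/eqP <-|ltj].
  rewrite coefB -{1}ss -!lead_coefE lead_coef_comp ?s2 //.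
  by rewrite lead_coefXaddC expr1n mulr1 subrr.
have gj : (size g <= j)%N by move: ltj; case: (size g).
by rewrite coefB !nth_default ?subrr ?ss.
Qed.

Lemma size_shift_comb (g : {poly k}) (a b : k) :
  (size (a *: (g \Po ('X + 1%:P)) - b *: g)%R <= size g)%N.
Proof.
rewrite (leq_trans (size_polyD _ _)) // size_polyN geq_max.
by rewrite !(leq_trans (size_scale_leq _ _)) // size_comp_poly2 // size_XaddC.
Qed.

Lemma pchar0_natr_inj : [pchar k] =i pred0 -> injective (fun i : nat => i%:R : k).
Proof.
move/(pcharf0P k) => ch0 i j; wlog le_ij : i j / (i <= j)%N => [H E|].
  by case/orP: (leq_total i j) => le; [apply: H | apply/esym/H].
move/esym/eqP; rewrite -subr_eq0 -natrB // ch0 subn_eq0 => le_ji.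
by apply/eqP; rewrite eqn_leq le_ij.
Qed.

(** In characteristic 0 the naturals are infinitely many distinct points; for a constant one value
    suffices. *)
Lemma poly_nat_roots (g : {poly k}) I0 :
  [pchar k] =i pred0 \/ (size g <= 1)%N ->
  (forall i : nat, (I0 <= i)%N -> g.[i%:R] = 0) -> g = 0.
Proof.
case=> [ch0|/size1_polyC ->] g0; last first.
  by have := g0 I0 (leqnn _); rewrite hornerC => ->.
apply/eqP; apply: contraT => gn0.
pose rs := [seq (i%:R : k) | i <- iota I0 (size g)].
have := @max_poly_roots _ g rs gn0; rewrite size_map size_iota ltnn => -> //.
  by apply/allP => _ /mapP[i + ->]; rewrite mem_iota => /andP[/g0/rootP].
by rewrite map_inj_uniq ?iota_uniq //; apply: pchar0_natr_inj.
Qed.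

(* The operator [H i |-> H i.+1 - beta j0 * H i] lowers the degree of the       *)
(* coefficient of [beta j0 ^+ i] and preserves the degrees of the others.       *)
Lemma exp_poly_eq0 (I : eqType) (r : seq I) (beta : I -> k) (g : I -> {poly k}) I0 :
  uniq r -> {in r &, injective beta} -> (forall j, beta j != 0) ->
  [pchar k] =i pred0 \/ (forall j, j \in r -> size (g j) <= 1)%N ->
  (forall i : nat, (I0 <= i)%N -> \sum_(j <- r) (g j).[i%:R] * beta j ^+ i = 0) ->
  forall j, j \in r -> g j = 0.
Proof.
move=> Ur beta_inj beta0; have [N] := ubnP (\sum_(j <- r) size (g j)).
elim: N g => // N IH g leN chr g0.
have [/hasP[j0 j0r gj0]|/hasPn all0] := boolP (has (fun j => g j != 0) r); last first.
  by move=> j /all0; rewrite negbK => /eqP.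
pose g' j := beta j *: (g j \Po ('X + 1%:P)) - beta j0 *: g j.
have sg' j : (size (g' j) <= size (g j))%N by apply: size_shift_comb.
have g'0 : forall j, j \in r -> g' j = 0.
  apply: IH => [|| i leI].
  - rewrite (leq_trans _ (leN : (_ <= N)%N)) // !(big_rem j0 j0r) /= -addSn leq_add //.
      by rewrite /g' -scalerBr size_scale ?beta0 ?size_shift_sub.
    by apply: leq_sum.
  - by case: chr => [|c]; [left | right=> j /c; apply: leq_trans].
  have /eqP : \sum_(j <- r) (g j).[i.+1%:R] * beta j ^+ i.+1 =
      beta j0 * \sum_(j <- r) (g j).[i%:R] * beta j ^+ i.
    by rewrite (g0 i leI) mulr0 g0 // leqW.
  rewrite -subr_eq0 mulr_sumr -sumrB => /eqP E; rewrite -[RHS]E; apply: eq_bigr => j _.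
  rewrite /g' hornerD hornerN !hornerZ horner_comp hornerD hornerX hornerC natr1.
  by rewrite mulrBl exprS -!mulrA [in RHS]mulrCA.
(* Comparing leading coefficients in [g' j = 0] gives [(beta j - beta j0) * lead_coef (g j) = 0]. *)
have gj j : j \in r -> j != j0 -> g j = 0.
  move=> jr jj0; have /eqP := g'0 j jr; rewrite subr_eq0 => /eqP/(congr1 lead_coef).
  rewrite !lead_coefZ lead_coef_comp ?size_XaddC // lead_coefXaddC expr1n mulr1.
  move/eqP; rewrite -subr_eq0 -mulrBl mulf_eq0 subr_eq0 lead_coef_eq0.
  by case/orP=> [/eqP/(beta_inj _ _ jr j0r) E|/eqP//]; rewrite E eqxx in jj0.
(* Only the term of [j0] is left, so [g j0] vanishes at all large naturals. *)
move: gj0; rewrite (_ : g j0 = 0) ?eqxx //; apply: (@poly_nat_roots _ I0) => [|i leI].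
  by case: chr => [|c]; [left | right; apply: c].
have := g0 i leI; rewrite (bigD1_seq j0) //= big_seq_cond big1 ?addr0.
  by move/eqP; rewrite mulf_eq0 (negbTE (expf_neq0 _ (beta0 j0))) orbF => /eqP.
by move=> j /andP[jr jj0]; rewrite gj // horner0 mul0r.
Qed.

End ExponentialPolynomials.

(** * Laurent monomials *)

Section Dot.
Variable n : nat.
Implicit Types (v m : 'rV[int]_n).

Definition dot v m : int := \sum_i v 0 i * m 0 i.

Lemma dotB v m m' : dot v (m - m') = dot v m - dot v m'.
Proof. by rewrite -sumrB; apply: eq_bigr => i _; rewrite !mxE mulrBr. Qed.

Lemma dot_delta i m : dot (delta_mx 0 i) m = m 0 i.
Proof.
rewrite /dot (bigD1 i) //= big1 => [|j ji]; rewrite !mxE eqxx ?eqxx ?mul1r ?addr0 //=.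
by rewrite (negbTE ji) mul0r.
Qed.

(** The vector [(1, B, B^2, ...)] works when [B] is a root of none of the nonzero polynomials with
    coefficient vectors [a - b]. *)
Lemma exists_dot_injective (S : seq 'rV[int]_n) :
  exists v, {in S &, injective (dot v)}.
Proof.
pose G := \prod_(u <- [seq (a, b) | a <- S, b <- S] | u.1 != u.2) rVpoly (u.1 - u.2).
have G0 : G != 0.
  rewrite prodf_seq_neq0; apply/allP => u _; apply/implyP; apply: contra => /eqP.
  move=> /(congr1 (@poly_rV _ n))/eqP.
  by rewrite rVpolyK linear0 subr_eq0 => ->.
have [B GB] : exists B : nat, G.[B%:R] != 0.
  apply: contrapT => /forallNP GB; case/eqP: G0.
  apply: (@poly_nat_roots _ _ 0) => [|i _]; first by left; apply: pchar_num.
  by apply: contrapT => /eqP /GB.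
exists (\row_i B%:R ^+ i) => a b aS bS dab; apply: contraNeq GB => ab.
rewrite horner_prod prodf_seq_eq0; apply/hasP; exists (a, b).
  by apply/allpairsP; exists (a, b).
rewrite /= ab /= horner_poly; move/eqP: dab; rewrite -subr_eq0 -dotB => /eqP dab.
apply/eqP; rewrite -[RHS]dab; apply: eq_bigr => i _.
by rewrite mxE valK mulrC.
Qed.

End Dot.

Lemma big_undup_fibers (V : nmodType) (I J : eqType) (g : I -> J) (r : seq I) (F : I -> V) :
  \sum_(m <- undup (map g r)) \sum_(i <- r | g i == m) F i = \sum_(i <- r) F i.
Proof.
rewrite (exchange_big_dep xpredT) //= big_seq [RHS]big_seq; apply: eq_bigr => i ir.
rewrite -big_filter (_ : [seq m <- _ | _] = [:: g i]) ?big_seq1 //.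
have gr : g i \in undup (map g r) by rewrite mem_undup map_f.
by rewrite -(filter_pred1_uniq (undup_uniq _) gr); apply: eq_filter => m /=; rewrite eq_sym.
Qed.

Section Monomials.
Variables (k : fieldType) (n : nat).
Implicit Types (x t : 'I_n -> k) (m v : 'rV[int]_n).

Definition monom_at x m : k := \prod_i x i ^ m 0 i.

Lemma monom_at0 x : monom_at x 0 = 1.
Proof. by rewrite /monom_at big1 // => i _; rewrite mxE expr0z. Qed.

Lemma monom_atD x m m' : (forall i, x i != 0) ->
  monom_at x (m + m') = monom_at x m * monom_at x m'.
Proof.
by move=> x0; rewrite -big_split; apply: eq_bigr => i _; rewrite mxE expfzDr.
Qed.

Lemma monom_atN x m : monom_at x (- m) = (monom_at x m)^-1.
Proof. by rewrite -prodfV; apply: eq_bigr => i _; rewrite mxE invr_expz. Qed.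

Lemma monom_at_neq0 x m : (forall i, x i != 0) -> monom_at x m != 0.
Proof. by move=> x0; apply/prodf_neq0 => i _; apply: expfz_neq0. Qed.

Lemma monom_atZ x (a : int) m : monom_at x (a *: m) = monom_at x m ^ a.
Proof.
rewrite /monom_at (big_morph (fun y : k => y ^ a) (fun y y' => expfzMl y y' a) (exp1rz _ a)).
by apply: eq_bigr => i _; rewrite mxE exprz_exp mulrC.
Qed.

Lemma monom_at_delta x i : monom_at x (delta_mx 0 i) = x i.
Proof.
rewrite /monom_at (bigD1 i) //= big1 => [|j ji]; first by rewrite mxE !eqxx mulr1 expr1z.
by rewrite mxE (negbTE ji) andbF expr0z.
Qed.

Lemma monom_atMl t x m :
  monom_at (fun i => t i * x i) m = monom_at t m * monom_at x m.
Proof. by rewrite -big_split; apply: eq_bigr => i _; rewrite expfzMl. Qed.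

Lemma monom_atX x m (j : nat) : monom_at (fun i => x i ^+ j) m = monom_at x m ^+ j.
Proof. by rewrite -prodrXl; apply: eq_bigr => i _; rewrite !exprnP !exprz_exp mulrC. Qed.

Lemma monom_at_curve (y : k) v m :
  y != 0 -> monom_at (fun i => y ^ v 0 i) m = y ^ dot v m.
Proof.
move=> y0; rewrite /dot /monom_at.
under eq_bigr => i _ do rewrite exprz_exp.
by rewrite (big_morph _ (fun a b => expfzDr a b y0) (expr0z y)).
Qed.

(** For [x = p] these values are the bases of the exponential polynomials in [i], which must be
    distinct. *)
Lemma monom_at_inj x : freely_generate x -> (forall i, x i != 0) ->
  injective (monom_at x).
Proof.
move=> x_free x0 m m' E; apply/rowP => i; apply/eqP; rewrite -subr_eq0.
have := @x_free (fun i => (m - m') 0 i) _ i; rewrite !mxE => -> //.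
by rewrite -[LHS]/(monom_at x (m - m')) monom_atD // monom_atN E divff ?monom_at_neq0.
Qed.

(* Functions of a point [(tau, t)] of the acting group; the flag [z] allows a   *)
(* polynomial dependence on [tau].                                              *)
Definition exp_fun (z : bool) (G : k * ('I_n -> k) -> k) :=
  exists s : seq ({poly k} * 'rV[int]_n),
    (forall u, u \in s -> z || (size u.1 <= 1)%N) /\
    forall tau t, (forall i, t i != 0) ->
      G (tau, t) = \sum_(u <- s) u.1.[tau] * monom_at t u.2.

Lemma exp_fun_algebra z : function_algebra (exp_fun z).
Proof.
split=> [F G FG [s [sz Fs]]|a|F G [s [sz Fs]] [r [rz Gr]]|F G [s [sz Fs]] [r [rz Gr]]].
- by exists s; split=> // tau t t0; rewrite -FG Fs.
- exists [:: (a%:P, 0)]; split=> [u|tau t t0].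
    by rewrite inE => /eqP -> /=; rewrite size_polyC leq_b1 orbT.
  by rewrite big_seq1 hornerC monom_at0 mulr1.
- exists (s ++ r); split=> [u|tau t t0]; last by rewrite big_cat Fs // Gr.
  by rewrite mem_cat => /orP[/sz|/rz].
- exists [seq (u.1 * w.1, u.2 + w.2) | u <- s, w <- r]; split=> [u|tau t t0].
    case/allpairsP=> -[[a m] [b m']] /= [/sz/= za /rz/= zb ->] /=.
    case: z za zb {sz rz} => //= /size1_polyC -> /size1_polyC ->.
    by rewrite -polyCM size_polyC leq_b1.
  rewrite big_allpairs_dep Fs // Gr // mulr_suml; apply: eq_bigr => u _.
  rewrite mulr_sumr; apply: eq_bigr => w _.
  by rewrite hornerM monom_atD // mulrACA.
Qed.

(** The points [(i, p^i)] with [i] large are Zariski dense in the acting group: along them [G] is an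
    exponential polynomial in [i] with the distinct bases [monom_at p m], so all its coefficients
    vanish. *)
Lemma exp_fun_dense (z : bool) (p : 'I_n -> k) I0 (G : k * ('I_n -> k) -> k) :
  (forall i, p i != 0) -> freely_generate p -> (z -> [pchar k] =i pred0) ->
  exp_fun z G ->
  (forall i : nat, (I0 <= i)%N -> G (i%:R, fun j => p j ^+ i) = 0) ->
  forall tau t, (forall i, t i != 0) -> G (tau, t) = 0.
Proof.
move=> p0 p_free z0 [s [sz Gs]] G0.
pose r := undup (map snd s); pose g m := \sum_(u <- s | u.2 == m) u.1.
have GE tau t : (forall i, t i != 0) ->
    G (tau, t) = \sum_(m <- r) (g m).[tau] * monom_at t m.
  move=> t0; rewrite Gs //.
  under [RHS]eq_bigr => m _ do rewrite horner_sum mulr_suml.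
  rewrite -(big_undup_fibers snd); apply: eq_bigr => m _.
  by apply: eq_bigr => u /eqP ->.
have g0 m : m \in r -> g m = 0.
  apply: (@exp_poly_eq0 _ _ r (monom_at p) g I0); first exact: undup_uniq.
  - by move=> a b _ _; apply: monom_at_inj.
  - by move=> a; apply: monom_at_neq0.
  - case: z z0 sz => z0 sz; [by left; apply: z0 | right=> a _].
    rewrite (leq_trans (size_sum _ _ _)) //; apply/bigmax_leqP_seq => u us _.
    exact: sz.
  - move=> i leI; rewrite -[RHS](G0 i leI) GE => [|j]; last by rewrite expf_neq0.
    by apply: eq_bigr => m' _; rewrite monom_atX.
move=> tau t t0; rewrite GE // big_seq big1 // => m /g0 ->.
by rewrite horner0 mul0r.
Qed.

End Monomials.

(** * The exponents of a lonely hypersurface *)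

Lemma natr_notin (k : idomainType) (L : seq k) : [pchar k] =i pred0 ->
  exists I0 : nat, forall i : nat, (I0 <= i)%N -> i%:R \notin L.
Proof.
move=> ch0; elim: L => [|a L [I0 IL]]; first by exists 0%N.
have [[j ja]|noj] := pselect (exists j : nat, j%:R = a).
  exists (maxn I0 j.+1) => i; rewrite geq_max => /andP[/IL iL ji].
  rewrite inE negb_or iL andbT -ja; apply/eqP => /(pchar0_natr_inj ch0) ij.
  by rewrite ij ltnn in ji.
exists I0 => i /IL iL; rewrite inE negb_or iL andbT.
by apply/eqP => ia; apply: noj; exists i.
Qed.

(** The roots of [f] have finitely many differences, which large naturals avoid in characteristic 0;
    a nonzero constant has no root. *)
Lemma no_root_shift (k : closedFieldType) (z : bool) (f : {poly k}) :
  (z -> [pchar k] =i pred0) -> z || (size f <= 1)%N -> f != 0 ->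
  exists I0 : nat, forall i b, (I0 <= i)%N -> root f b -> ~~ root f (b + i%:R).
Proof.
move=> z0 zf f0; have [s Ps] := closed_field_poly_normal f.
have rootE b : root f b -> b \in s.
  by rewrite Ps rootZ ?root_prod_XsubC // lead_coef_eq0.
case: z z0 zf => [/(_ isT) ch0 _|_ /= /size1_polyC fC].
  have [I0 HI] := @natr_notin _ [seq a - b | a <- s, b <- s] ch0.
  exists I0 => i b /HI iL /rootE bs; apply: contra iL => /rootE bis.
  by apply/allpairsP; exists (b + i%:R, b); rewrite bis bs addrC addKr.
exists 0%N => i b _; rewrite {1}fC /root hornerC => /eqP c0.
by rewrite fC c0 eqxx in f0.
Qed.

(** * Restriction of f to curves in a separating direction *)

Section Core.
Variables (k : closedFieldType) (n : nat) (p : 'I_n -> k) (z : bool).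
Hypotheses (p_neq0 : forall i, p i != 0) (p_free : freely_generate p).
Hypothesis z_char0 : z -> [pchar k] =i pred0.

Variables (S : seq 'rV[int]_n) (c : 'rV[int]_n -> {poly k}).
Hypotheses (S_uniq : uniq S) (c_neq0 : forall m, m \in S -> c m != 0).
Hypothesis c_size : forall m, z || (size (c m) <= 1)%N.

(** The value of [f] at [x_1 = b] and the torus point [x]; in Type B the [c m] are constants. *)
Definition sum_at (b : k) (x : 'I_n -> k) : k :=
  \sum_(m <- S) (c m).[b] * monom_at x m.

(** Loneliness tested at points: the translate of a zero by [(i, p^i)] is not a zero. *)
Hypothesis no_common_zero : forall (i : nat) b x, (0 < i)%N ->
  (forall j, x j != 0) -> sum_at b x = 0 ->
  sum_at (b + i%:R) (fun j => p j ^+ i * x j) != 0.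

Variables (v m0 m1 : 'rV[int]_n).
Hypothesis v_inj : {in S &, injective (dot v)}.
Hypotheses (m0S : m0 \in S) (m1S : m1 \in S) (m0_neq_m1 : m0 != m1).
Hypothesis dot_min : forall m, m \in S -> dot v m0 <= dot v m.
Hypothesis dot_max : forall m, m \in S -> dot v m <= dot v m1.

(** Exponent of [y] in the monomial [m] once [y ^ dot v m0] is divided out. On [S] the difference is
    nonnegative by [dot_min], so [absz] loses nothing. *)
Definition height m : nat := absz (dot v m - dot v m0).

Local Notation M := (height m1).

Lemma height_inj : {in S &, injective height}.
Proof.
move=> a b aS bS; rewrite /height => E; apply: v_inj => //.
by move: E (dot_min aS) (dot_min bS); clear; lia.
Qed.

Lemma height_le m : m \in S -> (height m <= M)%N.
Proof. by rewrite /height => mS; move: (dot_min mS) (dot_max mS); clear; lia. Qed.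

Lemma height0 : height m0 = 0%N.
Proof. by rewrite /height subrr. Qed.

Lemma heightM_gt0 : (0 < M)%N.
Proof.
rewrite lt0n -height0; apply: contraNneq m0_neq_m1 => E.
by rewrite (height_inj m1S m0S E).
Qed.

(** By [sum_at_curve] this is [f] along [y |-> y^v x], made into a polynomial in [y] of formal
    degree [M] by dividing out the lowest power. *)
Definition slice (b : k) (x : 'I_n -> k) : {poly k} :=
  \sum_(m <- S) ((c m).[b] * monom_at x m) *: 'X^(height m).

Lemma coef_slice b x j :
  (slice b x)`_j = \sum_(m <- S) (c m).[b] * monom_at x m * (j == height m)%:R.
Proof. by rewrite coef_sum; apply: eq_bigr => m _; rewrite coefZ coefXn. Qed.

Lemma coef_slice_height b x m :
  m \in S -> (slice b x)`_(height m) = (c m).[b] * monom_at x m.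
Proof.
move=> mS; rewrite coef_slice (bigD1_seq m) //= eqxx mulr1 big_seq_cond big1 ?addr0 //.
move=> m' /andP[m'S m'm]; case: eqP => [/(height_inj mS m'S) E|_]; last by rewrite mulr0.
by rewrite E eqxx in m'm.
Qed.

Lemma size_slice b x : (size (slice b x) <= M.+1)%N.
Proof.
rewrite /slice big_seq (leq_trans (size_sum _ _ _)) //; apply/bigmax_leqP_seq => m mS mS'.
by rewrite (leq_trans (size_scale_leq _ _)) // size_polyXn ltnS height_le.
Qed.

Lemma expz_dot (q : k) m : q != 0 -> m \in S ->
  q ^ dot v m = q ^ dot v m0 * q ^+ height m.
Proof.
move=> q0 mS; rewrite exprnP -expfzDr //; congr (_ ^ _).
by rewrite /height; move: (dot_min mS); clear; lia.
Qed.

(** Moving the base point by [q^v] rescales [y]; this is how ratios of roots enter. *)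
Lemma slice_scale b x q y : q != 0 ->
  (slice b (fun i => q ^ v 0 i * x i)).[y] = q ^ dot v m0 * (slice b x).[q * y].
Proof.
move=> q0; rewrite !horner_sum mulr_sumr big_seq [RHS]big_seq.
apply: eq_bigr => m mS; rewrite monom_atMl monom_at_curve // (expz_dot q0 mS).
rewrite !hornerZ !hornerXn exprMn !mulrA; congr (_ * _).
by rewrite [_ * q ^ dot v m0]mulrC mulrAC.
Qed.

Lemma sum_at_curve b x y : y != 0 ->
  sum_at b (fun i => y ^ v 0 i * x i) = y ^ dot v m0 * (slice b x).[y].
Proof.
move=> y0; have := slice_scale b x 1 y0; rewrite mulr1 => <-; rewrite horner_sum.
by apply: eq_bigr => m _; rewrite hornerZ hornerXn expr1n mulr1.
Qed.

(** * Elimination of y along the curve a^w *)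

Section Direction.
Variable w : 'rV[int]_n.

Definition curve (a : k) (i : 'I_n) : k := a ^ w 0 i.

Lemma curve_neq0 a : a != 0 -> forall i, curve a i != 0.
Proof. by move=> a0 i; apply: expfz_neq0. Qed.

(** The resultant in [y] of a slice and of its translate by [g = (tau, t)]. *)
Definition eliminant (b a : k) (g : k * ('I_n -> k)) : k :=
  \det (sylvester M (slice b (curve a))
          (slice (b + g.1) (fun i => g.2 i * curve a i))).

Lemma fa_sylvester X (C : (X -> k) -> Prop) (P Q : X -> {poly k}) :
  function_algebra C ->
  (forall j, C (fun x => (P x)`_j)) -> (forall j, C (fun x => (Q x)`_j)) ->
  C (fun x => \det (sylvester M (P x) (Q x))).
Proof.
move=> Calg CP CQ; apply: (fa_det Calg) => i j.
pose coefMX (R : X -> {poly k}) (l : 'I_M) x := if (j < l)%N then 0 else (R x)`_(j - l).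
have CMX (R : X -> {poly k}) l : (forall j, C (fun x => (R x)`_j)) -> C (coefMX R l).
  by move=> CR; rewrite /coefMX; case: (j < l)%N; [apply: (fa_cst Calg) | apply: CR].
case E : (split i) => [l|l].
  by apply: (fa_ext Calg) (CMX P l CP) => x; rewrite mxE E coefMXn.
by apply: (fa_ext Calg) (CMX Q l CQ) => x; rewrite mxE E coefMXn.
Qed.

Lemma fa_coef_slice X (C : (X -> k) -> Prop) (b : X -> k) (x : X -> 'I_n -> k) j :
  function_algebra C -> (forall m, C (fun u => (c m).[b u] * monom_at (x u) m)) ->
  C (fun u => (slice (b u) (x u))`_j).
Proof.
move=> Calg Cx; apply: (fa_ext Calg) (fun u => esym (coef_slice (b u) (x u) j)) _.
apply: (fa_sum Calg) => m; apply: (fa_mul Calg) (fa_cst Calg _); exact: Cx.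
Qed.

Lemma exp_fun_eliminant b a : exp_fun z (eliminant b a).
Proof.
have Calg := @exp_fun_algebra k n z.
apply: (fa_sylvester Calg) => j; first exact: (fa_cst Calg).
apply: (fa_coef_slice (b := fun g => b + g.1)
  (x := fun g i => g.2 i * curve a i) j Calg) => m.
exists [:: (monom_at (curve a) m *: (c m \Po ('X + b%:P)), m)]; split=> [u|tau t t0].
  rewrite inE => /eqP -> /=; case/orP: (c_size m) => [->//|cm].
  by rewrite (leq_trans (size_scale_leq _ _)) ?orbT // size_comp_poly2 // size_XaddC.
rewrite big_seq1 /= monom_atMl hornerZ horner_comp hornerD hornerX hornerC addrC.
by rewrite mulrA [LHS]mulrC mulrA.
Qed.

Lemma poly_fun_eliminant a g : poly_fun (fun b => eliminant b a g).
Proof.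
have Calg := poly_fun_algebra k.
apply: (fa_sylvester Calg) => j.
  apply: (fa_coef_slice (b := id) (x := fun _ => curve a) j Calg) => m.
  by apply: (fa_mul Calg) (fa_cst Calg _); exists (c m).
apply: (fa_coef_slice (b := fun b => b + g.1)
  (x := fun _ i => g.2 i * curve a i) j Calg) => m.
apply: (fa_mul Calg) (fa_cst Calg _).
exists (c m \Po ('X + g.1%:P)) => b.
by rewrite horner_comp !hornerE.
Qed.

Lemma laurent_fun_curve (u m : 'rV[int]_n) :
  laurent_fun (fun a : k => monom_at (fun i => a ^ u 0 i) m).
Proof.
have Calg := laurent_fun_algebra k.
apply: (fa_prod Calg) => i.
apply: (fa_ext Calg) (laurent_fun_expz k (u 0 i * m 0 i)) => a.
by rewrite exprz_exp.
Qed.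

Lemma laurent_fun_det b b' (x x' : k -> 'I_n -> k) :
  (forall m, laurent_fun (fun a => monom_at (x a) m)) ->
  (forall m, laurent_fun (fun a => monom_at (x' a) m)) ->
  laurent_fun (fun a => \det (sylvester M (slice b (x a)) (slice b' (x' a)))).
Proof.
have Calg := laurent_fun_algebra k; move=> Cx Cx'.
apply: (fa_sylvester Calg) => j.
  apply: (fa_coef_slice (b := fun=> b) j Calg) => m.
  exact: (fa_mul Calg) (fa_cst Calg _) (Cx m).
apply: (fa_coef_slice (b := fun=> b') j Calg) => m.
exact: (fa_mul Calg) (fa_cst Calg _) (Cx' m).
Qed.

Lemma laurent_fun_eliminant b g : laurent_fun (fun a => eliminant b a g).
Proof.
have Calg := laurent_fun_algebra k.
apply: laurent_fun_det => m; first exact: laurent_fun_curve.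
apply: (fa_ext Calg) (fun a => esym (monom_atMl g.2 (curve a) m)) _.
exact: (fa_mul Calg) (fa_cst Calg _) (laurent_fun_curve w m).
Qed.

(** A common root [y != 0] would be a common zero of [f] and its translate. A common root 0 needs
    [c m0] to vanish at both [b] and [b + i], and a simultaneous drop of degree needs the same of
    [c m1]; large [i] rules out both. *)
Lemma eliminant_generic : exists I0 : nat, forall i : nat, (I0 <= i)%N ->
  forall b a, a != 0 -> eliminant b a (i%:R, fun j => p j ^+ i) != 0.
Proof.
have cc0 : c m0 * c m1 != 0 by rewrite mulf_neq0 ?c_neq0.
have scc : z || (size (c m0 * c m1)%R <= 1)%N.
  have := c_size m0; have := c_size m1; case: (z) => //= /size1_polyC -> /size1_polyC ->.
  by rewrite -polyCM size_polyC leq_b1.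
have [I0 HI] := no_root_shift z_char0 scc cc0.
(* The bound 1 makes [i] positive, as [no_common_zero] requires. *)
exists (maxn I0 1) => i; rewrite geq_max => /andP[/HI {}HI i_gt0] b a a0.
have pc0 m : monom_at (fun j => p j ^+ i * curve a j) m != 0.
  by apply: monom_at_neq0 => j; rewrite mulf_neq0 ?expf_neq0 ?curve_neq0.
have mc0 m : monom_at (curve a) m != 0 by apply/monom_at_neq0/curve_neq0.
have shift m : (m == m0) || (m == m1) -> root (c m) b -> ~~ root (c m) (b + i%:R).
  move=> mm rb; apply/negP => rbi; have := HI b.
  by rewrite !rootM; case/orP: mm => /eqP mE; rewrite -!mE rb rbi ?orbT => /(_ isT).
apply: det_sylvester_neq0; rewrite ?size_slice //=.
- have [rb|rb] := boolP (root (c m1) b).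
    apply/orP; right; rewrite ltnNge; apply/negP => /leq_sizeP/(_ _ (leqnn _))/eqP.
    rewrite coef_slice_height // mulf_eq0 (negbTE (pc0 _)) orbF; apply/negP.
    by apply: shift rb; rewrite eqxx orbT.
  apply/orP; left; rewrite ltnNge; apply/negP => /leq_sizeP/(_ _ (leqnn _))/eqP.
  by rewrite coef_slice_height // mulf_eq0 (negbTE (mc0 _)) orbF; apply/negP.
move=> y ry; apply/negP => ry'; have [y0|y0] := eqVneq y 0.
  have at0 b' x : (forall m, monom_at x m != 0) -> root (slice b' x) 0 -> root (c m0) b'.
    move=> x0; rewrite /root horner_coef0 -{1}height0 coef_slice_height // mulf_eq0.
    by rewrite (negbTE (x0 _)) orbF.
  rewrite y0 in ry ry'; have := shift m0; rewrite eqxx => /(_ isT (at0 _ _ mc0 ry)).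
  by rewrite (at0 _ _ pc0 ry').
have x0 j : y ^ v 0 j * curve a j != 0 by rewrite mulf_neq0 ?expfz_neq0 ?curve_neq0.
have := no_common_zero (b := b) i_gt0 x0.
rewrite sum_at_curve // (rootP ry) mulr0 => /(_ erefl).
rewrite (_ : (fun j => _) = (fun j => y ^ v 0 j * (p j ^+ i * curve a j))).
  by rewrite sum_at_curve // (rootP ry') mulr0 eqxx.
by apply/funext => j; rewrite mulrCA.
Qed.

Lemma eliminant_dense (G : k * ('I_n -> k) -> k) : exp_fun z G ->
  (exists I0 : nat, forall i : nat, (I0 <= i)%N -> G (i%:R, fun j => p j ^+ i) = 0) ->
  forall tau t, (forall i, t i != 0) -> G (tau, t) = 0.
Proof. by move=> GE [I0 G0]; exact: (exp_fun_dense p_neq0 p_free z_char0 GE G0). Qed.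

(** At [(i, p^i)] with [i] large the eliminant is a polynomial in [b] without zeros, hence constant;
    density extends the identity to all [(tau, t)]. *)
Lemma eliminant_indep b a tau t : a != 0 -> (forall i, t i != 0) ->
  eliminant b a (tau, t) = eliminant 0 a (tau, t).
Proof.
move=> a0 t0; apply/eqP; rewrite -subr_eq0; apply/eqP.
have Calg := @exp_fun_algebra k n z.
apply: (eliminant_dense (G := fun g => eliminant b a g - eliminant 0 a g)) t0.
  have C1 := fa_mul Calg (fa_cst Calg (-1)) (exp_fun_eliminant 0 a).
  apply: (fa_ext Calg) (fa_add Calg (exp_fun_eliminant b a) C1) => g.
  by rewrite mulN1r.
have [I0 HI] := eliminant_generic; exists I0 => i /HI {}HI; apply/eqP; rewrite subr_eq0.
apply/eqP; apply: (poly_fun_neq0 (poly_fun_eliminant a _)) => b'; exact: HI.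
Qed.

(** The same argument in [a], where having no zeros means being a monomial. *)
Lemma eliminant_mul a a' tau t : a != 0 -> a' != 0 -> (forall i, t i != 0) ->
  eliminant 0 a (tau, t) * eliminant 0 a' (tau, t) =
  eliminant 0 1 (tau, t) * eliminant 0 (a * a') (tau, t).
Proof.
move=> a0 a'0 t0; apply/eqP; rewrite -subr_eq0; apply/eqP.
have Calg := @exp_fun_algebra k n z.
pose E a := eliminant 0 a.
apply: (eliminant_dense (G := fun g => E a g * E a' g - E 1 g * E (a * a') g)) t0.
  have C1 := fa_mul Calg (exp_fun_eliminant 0 1) (exp_fun_eliminant 0 (a * a')).
  have C2 := fa_mul Calg (fa_cst Calg (-1)) C1.
  have C3 := fa_mul Calg (exp_fun_eliminant 0 a) (exp_fun_eliminant 0 a').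
  by apply: (fa_ext Calg) (fa_add Calg C3 C2) => g; rewrite mulN1r.
have [I0 HI] := eliminant_generic; exists I0 => i /HI {}HI; apply/eqP; rewrite subr_eq0.
by apply/eqP; apply: (laurent_fun_neq0 (laurent_fun_eliminant 0 _)) => // u u0; apply: HI.
Qed.

(** By [slice_scale] the translate by [(0, q^v)] has the roots of the slice divided by [q], so this
    vanishes when [q] is a ratio of two roots. *)
Definition ratio_eliminant (q : k) : k := eliminant 0 1 (0, fun i => q ^ v 0 i).

Lemma laurent_fun_ratio_eliminant : laurent_fun ratio_eliminant.
Proof.
have Calg := laurent_fun_algebra k.
apply: (@laurent_fun_det 0 (0 + 0) (fun=> curve 1)
  (fun q i => q ^ v 0 i * curve 1 i)) => m; first exact: (fa_cst Calg).
apply: (fa_ext Calg) (fun q => esym (monom_atMl (fun i => q ^ v 0 i) (curve 1) m)) _.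
exact: (fa_mul Calg) (laurent_fun_curve v m) (fa_cst Calg _).
Qed.

(** Taking [a' = a^-1] in [eliminant_mul] turns a zero at [a] into a zero of the square of the value
    at 1. *)
Lemma eliminant_ratio b a q : a != 0 -> q != 0 ->
  eliminant b a (0, fun i => q ^ v 0 i) = 0 -> ratio_eliminant q = 0.
Proof.
move=> a0 q0; have t0 i : q ^ v 0 i != 0 by apply: expfz_neq0.
rewrite eliminant_indep // => E.
have a'0 : a^-1 != 0 by rewrite invr_eq0.
have := eliminant_mul 0 a0 a'0 t0; rewrite E mul0r divff // => /esym/eqP.
by rewrite mulf_eq0 orbb => /eqP.
Qed.

Lemma eliminant_common_root b a q y : q != 0 ->
  root (slice b (curve a)) y -> root (slice b (curve a)) (q * y) ->
  eliminant b a (0, fun i => q ^ v 0 i) = 0.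
Proof.
move=> q0 ry rqy; apply: (det_sylvester_root heightM_gt0 _ _ ry); rewrite ?size_slice //.
by rewrite /root addr0 slice_scale // (rootP rqy) mulr0.
Qed.

Lemma slice_lead_eq0 b x : (c m1).[b] = 0 -> (size (slice b x) <= M)%N.
Proof.
move=> cb; apply/leq_sizeP => j; rewrite leq_eqVlt => /orP[/eqP <-|ltj].
  by rewrite coef_slice_height // cb mul0r.
by rewrite nth_default // (leq_trans (size_slice b x)).
Qed.

Lemma slice_root0 b x : (forall i, x i != 0) ->
  root (slice b x) 0 = root (c m0) b.
Proof.
move=> x0; rewrite /root horner_coef0 -{1}height0 coef_slice_height // mulf_eq0.
by rewrite (negbTE (monom_at_neq0 _ x0)) orbF.
Qed.

(** For [b] off the zeros of [c m0 * c m1] the slice has full degree and nonzero roots; any [q != 0]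
    outside their finitely many ratios works, and [eliminant_indep] moves [b] to 0. *)
Lemma ratio_elim_neq0 : exists2 q, q != 0 & ratio_eliminant q != 0.
Proof.
have /closed_nonrootP[b] : c m0 * c m1 != 0 by rewrite mulf_neq0 ?c_neq0.
rewrite rootM negb_or => /andP[cb0 cb1].
have x0 i : curve 1 i != 0 by apply: curve_neq0; rewrite oner_neq0.
pose P := slice b (curve 1).
have PM : (M < size P)%N.
  rewrite ltnNge; apply/negP => /leq_sizeP/(_ _ (leqnn _))/eqP; apply/negP.
  by rewrite coef_slice_height // mulf_neq0 ?monom_at_neq0.
have P0 : P != 0 by rewrite -size_poly_gt0 (leq_ltn_trans _ PM).
have [s Ps] := closed_field_poly_normal P.
have rootE y : root P y -> y \in s.
  by rewrite Ps rootZ ?root_prod_XsubC // lead_coef_eq0.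
have [q] := exists_notin (0 :: [seq y' / y | y' <- s, y <- s]).
rewrite inE negb_or => /andP[q0 qs]; exists q => //.
have t0 i : q ^ v 0 i != 0 by apply: expfz_neq0.
rewrite /ratio_eliminant -(eliminant_indep b) ?oner_neq0 //.
apply: det_sylvester_neq0; rewrite ?size_slice ?PM //= => y ry.
rewrite /root addr0 slice_scale // mulf_eq0 (negbTE (expfz_neq0 _ q0)) /=.
apply: contra qs => /rootE qys; apply/allpairsP; exists (q * y, y); split=> //=.
  exact: rootE.
by rewrite mulfK //; apply: contraNneq cb0 => y0; rewrite -(slice_root0 b x0) -y0.
Qed.

(** A zero of [c m0] creates the common root 0 for every [q], and a zero of [c m1] lowers both
    degrees for every [q]. Either way [ratio_eliminant] would vanish identically off 0. *)
Lemma extremal_neq0 m b : (m == m0) || (m == m1) -> ~~ root (c m) b.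
Proof.
move=> mm; apply/negP => rb; have [q q0 /eqP] := ratio_elim_neq0; apply.
apply: (@eliminant_ratio b 1) => //; first by rewrite oner_neq0.
have x0 i : curve 1 i != 0 by apply: curve_neq0; rewrite oner_neq0.
case/orP: mm => /eqP mE; rewrite mE in rb.
  by apply: (@eliminant_common_root _ _ _ 0) => //; rewrite ?mulr0 slice_root0.
by apply: det_sylvester_lead heightM_gt0 _ _; apply: slice_lead_eq0;
  rewrite ?addr0; apply/rootP.
Qed.

(** The zeros of [ratio_eliminant] serve as [Q] for all [b] and [a] at once. *)
Lemma slice_ratio_finite : exists Q : seq k, forall b a, a != 0 -> forall x y,
  root (slice b (curve a)) x -> root (slice b (curve a)) y -> x != 0 /\ y / x \in Q.
Proof.
have [q0 q0n rq0] := ratio_elim_neq0.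
have [Q HQ] := laurent_fun_zeros laurent_fun_ratio_eliminant q0n rq0.
exists Q => b a a0 x y rx ry.
have root_neq0 u : root (slice b (curve a)) u -> u != 0.
  apply: contraTneq => ->; rewrite (slice_root0 _ (curve_neq0 a0)).
  by apply: extremal_neq0; rewrite eqxx.
have [x0 y0] := (root_neq0 _ rx, root_neq0 _ ry); split=> //.
have yx0 : y / x != 0 by rewrite mulf_neq0 ?invr_eq0.
apply: (HQ _ yx0); apply: (eliminant_ratio a0 yx0); apply: eliminant_common_root rx _ => //.
by rewrite divfK.
Qed.

(** This is [coef_ratio_finite] for the slice, with the dependence on [b] and the power of [a]
    separated. *)
Lemma coef_finite : exists K : seq k, forall b a m, a != 0 -> m \in S ->
  ((c m).[b] / (c m1).[b]) ^+ M / ((c m0).[b] / (c m1).[b]) ^+ (M - height m) *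
  a ^ ((dot w m - dot w m1) * M%:Z - (dot w m0 - dot w m1) * (M - height m)%N%:Z)
    \in K.
Proof.
have [Q HQ] := slice_ratio_finite; have [K HK] := coef_ratio_finite Q M.
exists K => b a m a0 mS; have jM := height_le mS.
have sP : size (slice b (curve a)) = M.+1.
  apply/eqP; rewrite eqn_leq size_slice ltnNge; apply/negP.
  move/leq_sizeP/(_ _ (leqnn _))/eqP; apply/negP; rewrite coef_slice_height // mulf_neq0 //.
    by apply: extremal_neq0; rewrite eqxx orbT.
  exact/monom_at_neq0/curve_neq0.
have := HK _ sP (HQ b a a0) _ jM; rewrite -height0 !coef_slice_height //.
rewrite !monom_at_curve // -!mulf_div !exprMn -mulf_div; congr (_ * _ \in K).
have quo (x y : int) : a ^ x / a ^ y = a ^ (x - y) by rewrite expfzDr // invr_expz.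
by rewrite -!exprMn !quo !exprnP !exprz_exp quo.
Qed.

End Direction.

(** * Constant coefficients and collinear exponents *)

Lemma size_extremal m : (m == m0) || (m == m1) -> size (c m) = 1%N.
Proof. by move=> mm; apply: no_root_size1 => b; exact: (extremal_neq0 0). Qed.

(** Fixing [a = 1] and varying [b], the polynomial [c m ^+ M] takes finitely many values, so it is
    constant. *)
Lemma coef_constant m : m \in S -> size (c m) = 1%N.
Proof.
move=> mS; have [K HK] := coef_finite 0.
have /eqP/size_poly1P[a0 a00 c0] : size (c m0) = 1%N by rewrite size_extremal ?eqxx.
have /eqP/size_poly1P[a1 a10 c1] : size (c m1) = 1%N by rewrite size_extremal ?eqxx ?orbT.
(* Multiplication by [d] turns the expression of [coef_finite] into [(c m).[b] ^+ M]. *)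
pose d := a1 ^+ M * (a0 / a1) ^+ (M - height m).
have d0 : d != 0 by rewrite mulf_neq0 ?expf_neq0 // mulf_neq0 ?invr_eq0.
have sM : (size (c m ^+ M) <= 1)%N.
  apply: (@size_finite_values _ _ [seq x * d | x <- K]) => b.
  apply/mapP; have := HK b 1 m (oner_neq0 _) mS; rewrite exp1rz mulr1 => bK.
  exists (((c m).[b] / (c m1).[b]) ^+ M / ((c m0).[b] / (c m1).[b]) ^+ (M - height m)) => //.
  rewrite c0 c1 !hornerC horner_exp /d expr_div_n mulrACA divfK ?expf_neq0 //.
  by rewrite mulVf ?mulr1 ?expf_neq0 ?mulf_neq0 ?invr_eq0.
have cm0 : (0 < size (c m))%N by rewrite size_poly_gt0 c_neq0.
have /eqP : ((size (c m)).-1 * M = 0)%N.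
  by rewrite -size_exp; move: sM; case: (size _) => [|[]].
rewrite muln_eq0 (gtn_eqF heightM_gt0) orbF => /eqP.
by move: cm0; case: (size _) => [|[]].
Qed.

(** Fixing [b = 0] and taking for [w] a basis vector, a power of [a] takes finitely many values, so
    its exponent is 0. This is the claim in one coordinate. *)
Lemma support_line m : m \in S ->
  M%:Z *: (m - m0) = (height m)%:Z *: (m1 - m0).
Proof.
move=> mS; apply/rowP => i; pose w : 'rV[int]_n := delta_mx 0 i.
have [K HK] := coef_finite w; have jM := height_le mS.
have cE m' : m' \in S -> exists2 a, a != 0 & c m' = a%:P.
  by move=> /coef_constant/eqP/size_poly1P[a a0 ->]; exists a.
have [[a a_n ca] [a0 a0_n ca0] [a1 a1_n ca1]] := And3 (cE _ mS) (cE _ m0S) (cE _ m1S).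
pose d := (a / a1) ^+ M / (a0 / a1) ^+ (M - height m).
have d0 : d != 0 by rewrite /d mulf_neq0 ?invr_eq0 ?expf_neq0 ?mulf_neq0 ?invr_eq0.
have E : (m 0 i - m1 0 i) * M%:Z - (m0 0 i - m1 0 i) * (M - height m)%N%:Z = 0.
  apply: (@expz_finite_values k _ [seq x / d | x <- K]) => x x0.
  apply/mapP; have := HK 0 x m x0 mS; rewrite !dot_delta ca ca0 ca1 !hornerC => xK.
  by eexists; [exact: xK | rewrite -/d mulrAC divff ?mul1r].
rewrite !mxE; move: (m 0 i) (m0 0 i) (m1 0 i) (height m) M jM E => x x0 x1 h N le_hN.
rewrite -subzn // => E; lia.
Qed.

End Core.

Lemma exists_min_seq (T : eqType) (f : T -> int) (s : seq T) x : x \in s ->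
  exists2 m, m \in s & forall y, y \in s -> f m <= f y.
Proof.
elim: s x => // a s IH x _; case: s IH => [_|b s /(_ b (mem_head _ _)) [m ms mle]].
  by exists a => [|y]; rewrite inE // => /eqP ->.
have [le|/ltW le] := leP (f a) (f m).
  exists a => [|y]; rewrite inE ?eqxx // => /orP[/eqP -> //|/mle].
  exact: le_trans.
exists m => [|y]; rewrite inE ?ms ?orbT // => /orP[/eqP -> //|]; exact: mle.
Qed.

(** The vectors [d] in question form a group on which a coordinate [i] with [D 0 i != 0] is
    injective. An element [e] whose [i]-th coordinate is nonzero and smallest in absolute value
    generates it, by Euclidean division. *)
Lemma exists_primitive n (N : nat) (D : 'rV[int]_n) : (0 < N)%N -> D != 0 ->
  exists e : 'rV[int]_n, forall d j, N%:Z *: d = j *: D -> exists a, d = a *: e.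
Proof.
move=> N0 D0; have N0z : N%:Z != 0 by rewrite eqz_nat -lt0n.
have [i Di] : exists i, D 0 i != 0.
  apply: contrapT => /forallNP H; case/eqP: D0; apply/rowP => i; rewrite mxE.
  by apply: contrapT => /eqP /H.
pose L d := exists j, N%:Z *: d = j *: D.
have L_inj d : L d -> d 0 i = 0 -> d = 0.
  move=> [j /rowP Ld] di0; have := Ld i; rewrite !mxE di0 mulr0 => /esym/eqP.
  rewrite mulf_eq0 (negbTE Di) orbF => /eqP j0; apply/rowP => l; have := Ld l.
  by rewrite j0 !mxE mul0r => /eqP; rewrite mulf_eq0 (negbTE N0z) => /eqP.
pose P (s : nat) := `[< exists2 e, L e & (0 < s)%N && (absz (e 0 i) == s) >].
have exP : exists s, P s.
  exists (absz (D 0 i)); apply/asboolP; exists D; first by exists N%:Z.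
  by rewrite eqxx andbT absz_gt0.
case: (ex_minnP exP) => s /asboolP[e Le /andP[s0 /eqP es]] s_min.
have ei0 : e 0 i != 0 by rewrite -absz_gt0 es.
exists e => d j Ld; exists (divz (d 0 i) (e 0 i)); apply/eqP; rewrite -subr_eq0; apply/eqP.
have modE : (d - divz (d 0 i) (e 0 i) *: e) 0 i = modz (d 0 i) (e 0 i).
  by rewrite !mxE.
apply: L_inj.
  case: Le => l Le; exists (j - divz (d 0 i) (e 0 i) * l).
  by rewrite scalerBr scalerA mulrC -scalerA Le Ld scalerA scalerBl.
rewrite modE; apply/eqP; apply: contraT => mod0.
have := s_min (absz (modz (d 0 i) (e 0 i))); rewrite leqNgt => /(_ _)/negP[].
  apply/asboolP; exists (d - divz (d 0 i) (e 0 i) *: e); last by rewrite modE eqxx absz_gt0 mod0.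
  case: Le => l Le; exists (j - divz (d 0 i) (e 0 i) * l).
  by rewrite scalerBr scalerA mulrC -scalerA Le Ld scalerA scalerBl.
rewrite -es; have := ltz_mod (d 0 i) ei0; have := modz_ge0 (d 0 i) ei0.
by move: (modz _ _) => r; lia.
Qed.

(** The exponents [m0] and [m1] are extremal for a separating direction. By [support_line] all
    [m - m0] are rational multiples of [m1 - m0], and [exists_primitive] gives them a common
    integral generator. *)
Theorem support_on_line (k : closedFieldType) (n : nat) (p : 'I_n -> k) (z : bool)
    (S : seq 'rV[int]_n) (c : 'rV[int]_n -> {poly k}) :
  (forall i, p i != 0) -> freely_generate p -> (z -> [pchar k] =i pred0) ->
  uniq S -> (forall m, m \in S -> c m != 0) -> (forall m, z || (size (c m) <= 1)%N) ->
  (forall (i : nat) b x, (0 < i)%N -> (forall j, x j != 0) -> sum_at S c b x = 0 ->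
    sum_at S c (b + i%:R) (fun j => p j ^+ i * x j) != 0) ->
  (1 < size S)%N ->
  (forall m, m \in S -> size (c m) = 1%N) /\
  exists (m0 e : 'rV[int]_n) (l : 'rV[int]_n -> int),
    forall m, m \in S -> m = m0 + l m *: e.
Proof.
move=> p0 p_free z0 US c0 cz disj S2.
have [v v_inj] := exists_dot_injective S.
have [x xS] : exists x, x \in S by case: (S) S2 => // x r _; exists x; rewrite mem_head.
have [m0 m0S m0_min] := exists_min_seq (dot v) xS.
have [m1 m1S m1_max] := exists_min_seq (fun m => - dot v m) xS.
have {}m1_max m : m \in S -> dot v m <= dot v m1 by move/m1_max; rewrite lerN2.
have m01 : m0 != m1.
  apply/eqP => E; suff : (size S <= size [:: m0])%N by rewrite leqNgt S2.
  apply: uniq_leq_size => // m mS; rewrite inE; apply/eqP.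
  by apply: v_inj => //; apply/eqP; rewrite eq_le m0_min // E m1_max.
split; first by move=> m; apply: (coef_constant p0 p_free z0 US c0 cz disj v_inj m0S m1S m01).
have D0 : m1 - m0 != 0 by rewrite subr_eq0 eq_sym.
have M0 := heightM_gt0 v_inj m0S m1S m01 m0_min.
have [e He] := exists_primitive M0 D0.
have /choice[l Hl] : forall m, exists a : int, m \in S -> m = m0 + a *: e.
  move=> m; have [mS|_] := boolP (m \in S); last by exists 0.
  have [|a ma] := He (m - m0) (height v m0 m)%:Z; last by exists a; rewrite -ma addrC subrK.
  exact: (support_line p0 p_free z0 US c0 cz disj v_inj m0S m1S m01).
by exists m0, e, l.
Qed.

(** * Prime ideals and lonely closed sets *)

Section Kernel.
Variables (R : comNzRingType) (F : fieldType) (phi : {rmorphism R -> F}).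

(** Kernels of evaluations are the primes at which loneliness gets tested. *)
Definition kernel : {pred R} := fun a => phi a == 0.

Lemma mem_kernel a : (a \in kernel) = (phi a == 0).
Proof. by []. Qed.

Lemma kernel_idealr : idealr_closed kernel.
Proof.
split=> [||a u v]; rewrite !mem_kernel ?rmorph0 ?rmorph1 ?oner_eq0 ?eqxx //.
by rewrite rmorphD rmorphM => /eqP -> /eqP ->; rewrite mulr0 addr0.
Qed.

Lemma kernel_prime : prime_idealr_closed kernel.
Proof. by move=> u v; rewrite !mem_kernel rmorphM mulf_eq0. Qed.

HB.instance Definition _ := isIdealr.Build R kernel kernel_idealr.
HB.instance Definition _ := isPrimeIdealrClosed.Build R kernel kernel_prime.

Definition kernel_spec : spec R := PrimeIdealr.clone R kernel _.

End Kernel.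

Section Lonely.
Variables (R : comNzRingType) (s : {rmorphism R -> R}).

Lemma mem_iter_spec_map i (P : spec R) a :
  (a \in iter i (spec_map s) P) = (iter i s a \in P).
Proof. by elim: i a => // i IH a; rewrite iterS iterSr -IH -mem_comap. Qed.

(** If [P] is the [i]-th image of [Q], then [f] lies in [P] exactly when [iter i s f] lies in [Q],
    so opposite exponents give the same condition. *)
Lemma lonelyP (f : R) :
  lonely (spec_map s) (vanishing_set f) <->
  forall (i : nat) (P : spec R), (0 < i)%N -> f \in P -> iter i s f \notin P.
Proof.
split=> [lon i P i0 fP|H i i0].
  apply/negP => sfP; case: i i0 sfP => // i _ sfP.
  have : (vanishing_set f `&` zimage (spec_map s) (Negz i) (vanishing_set f))%classic P.
    by split=> //; change (f \in iter i.+1 (spec_map s) P); rewrite mem_iter_spec_map.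
  by rewrite lon.
apply/seteqP; split=> // P []; rewrite /vanishing_set /= => fP.
case: i i0 => i i0 => [[Q fQ QP]|].
  move: fP; rewrite -QP mem_iter_spec_map; apply/negP; apply: H => //.
  by rewrite lt0n.
rewrite -[zimage _ _ _ P]/(is_true (f \in iter i.+1 (spec_map s) P)) mem_iter_spec_map.
exact/negP/H.
Qed.

Lemma iter_rmorphM i a b : iter i s (a * b) = iter i s a * iter i s b.
Proof. by elim: i => // i IH; rewrite !iterS IH rmorphM. Qed.

End Lonely.

(** * Loneliness from Bezout's identity *)

Section HornerAlg.
Variables (k : closedFieldType) (A : comAlgType k).

Lemma lrmorph_horner_alg (s : {lrmorphism A -> A}) a (G : {poly k}) :
  s (horner_alg a G) = horner_alg (s a) G.
Proof.
elim/poly_ind: G => [|G c IH]; first by rewrite !rmorph0.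
rewrite !(rmorphD, rmorphM) /= IH; congr (_ * _ + _); first by rewrite !horner_algX.
by rewrite !horner_algC linearZ rmorph1.
Qed.

Lemma horner_alg_comp (a : A) (G L : {poly k}) :
  horner_alg (horner_alg a L) G = horner_alg a (G \Po L).
Proof.
elim/poly_ind: G => [|G c IH]; first by rewrite comp_poly0 !rmorph0.
rewrite comp_poly_MXaddC !(rmorphD, rmorphM) /= IH !horner_algX; congr (_ + _).
by rewrite !horner_algC.
Qed.

(** A prime containing [f] and its [i]-th image contains the values at [a] of [G] and [G \Po L i],
    hence 1 by Bezout. *)
Lemma lonely_of_coprime (s : {lrmorphism A -> A}) (f u a : A) (G : {poly k})
    (L : nat -> {poly k}) :
  u * f = horner_alg a G -> (forall i, iter i s a = horner_alg a (L i)) ->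
  (forall i, (0 < i)%N -> coprimep G (G \Po L i)) ->
  lonely (spec_map s) (vanishing_set f).
Proof.
move=> uf sa cop; apply/lonelyP => i P i0 fP; apply/negP => sfP.
have GP : horner_alg a G \in P by rewrite -uf idealMr.
have GsP : horner_alg a (G \Po L i) \in P.
  suff <- : iter i s (u * f) = horner_alg a (G \Po L i) by rewrite iter_rmorphM idealMr.
  rewrite uf -horner_alg_comp -sa; elim: (i) => // j IH.
  by rewrite !iterS IH lrmorph_horner_alg.
have /Bezout_eq1_coprimepP[[U V] /= UV] := cop i i0.
have : horner_alg a (U * G + V * (G \Po L i)) \in P.
  by rewrite rmorphD !rmorphM /= rpredD // idealMr.
by rewrite UV rmorph1 idealr1.
Qed.

End HornerAlg.

(** * Laurent polynomials in one variable *)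

Section LaurentEval.
Variable k : closedFieldType.

Lemma laurent_evalE (A : comUnitRingType) (phi : {rmorphism k -> A}) a (g : laurent1 k) :
  laurent_eval phi a g = mmap phi (fun j => a ^ j) g.
Proof. by []. Qed.

Lemma laurent_eval_sum (A : comUnitRingType) (phi : {rmorphism k -> A}) (a : A)
    I (r : seq I) (c : I -> k) (d : I -> int) :
  laurent_eval phi a (\sum_(i <- r) << c i *g d i >> : {malg k[int]}) =
  \sum_(i <- r) phi (c i) * a ^ d i.
Proof. by rewrite laurent_evalE raddf_sum; apply: eq_bigr => i _; apply: mmapU. Qed.

(** Multiplication by a large power [N] of the variable gives a polynomial, and its factor ['X^K] is
    split off, so [d = K - N]. The same [d] and [G] serve for evaluation in [A] and in [k]. *)
Lemma laurent_eval_poly (g : laurent1 k) : g != 0 ->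
  exists (d : int) (G : {poly k}), ~~ root G 0 /\
    forall (A : comUnitRingType) (phi : {rmorphism k -> A}) a, a \is a GRing.unit ->
      laurent_eval phi a g = a ^ d * (map_poly phi G).[a].
Proof.
move=> g0; pose N := \max_(j <- msupp (g : {malg k[int]})) absz j.
have jN j : j \in msupp (g : {malg k[int]}) -> 0 <= j + N%:Z.
  move=> jg; have := @leq_bigmax_seq _ _ xpredT (fun j : int => absz j) j jg isT.
  by rewrite -/N; move: N => N'; lia.
pose G := \sum_(j <- msupp (g : {malg k[int]})) ((g : {malg k[int]})@_j)%:P * 'X^(absz (j + N%:Z)).
have G0 : G != 0.
  have [j jg] : exists j, j \in msupp (g : {malg k[int]}).
    have [E|[j jg]] := fset_0Vmem (msupp (g : {malg k[int]})); last by exists j.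
    by case/eqP: g0; rewrite [LHS](@monalgE _ _ (g : {malg k[int]})) E big_seq_fset0.
  apply: contraTneq (jg) => GE; rewrite -mcoeff_eq0; apply/eqP.
  have <- : G`_(absz (j + N%:Z)) = (g : {malg k[int]})@_j; last by rewrite GE coef0.
  rewrite coef_sum (bigD1_seq j) ?fset_uniq //= big_seq_cond big1 => [|l /andP[lg lj]].
    by rewrite addr0 coefCM coefXn eqxx mulr1.
  rewrite coefCM coefXn; case: eqP => [E|_]; last by rewrite mulr0.
  by case/eqP: lj; move: (jN _ lg) (jN _ jg) E; clear; lia.
have [K [Q]] := multiplicity_XsubC G 0; rewrite G0 polyC0 subr0 /= => Q0 GE.
exists (K%:Z - N%:Z), Q; split=> // A phi a ua.
have : (map_poly phi G).[a] = a ^ N%:Z * laurent_eval phi a g.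
  rewrite rmorph_sum horner_sum /laurent_eval mulr_sumr big_seq [RHS]big_seq.
  apply: eq_bigr => j /jN jN'; rewrite /= rmorphM /= map_polyC map_polyXn hornerCM hornerXn mulrCA.
  by rewrite -exprzDr // [N%:Z + _]addrC exprnP gez0_abs.
rewrite GE rmorphM /= map_polyXn hornerM hornerXn => E.
have -> : laurent_eval phi a g = a ^ (- N%:Z) * (a ^ N%:Z * laurent_eval phi a g).
  by rewrite mulrA -exprzDr // addNr expr0z mul1r.
by rewrite -E mulrCA mulrC exprnP -exprzDr // addrC.
Qed.

End LaurentEval.

(** * Monoid algebras *)

Section MonoidAlgEval.
Variables (k : fieldType) (E : nmodType).
Implicit Types (f g : monoid_alg k E) (a b : E).

Definition mono a : monoid_alg k E := << a >>.

Lemma mono0 : mono 0 = 1. Proof. by []. Qed.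

Lemma monoD a b : mono (a + b) = mono a * mono b.
Proof. by rewrite [RHS]ma_mulUU mulr1. Qed.

Lemma scale_mono (x : k) a : x *: mono a = << x *g a >>.
Proof.
apply/malgP => b; rewrite [LHS](@mcoeffZ _ k x (<< a >> : {malg k[E]})) !mcoeffU.
by rewrite mulrnAr mulr1.
Qed.

Lemma malg_sum f : f = \sum_(a <- msupp (f : {malg k[E]})) (f : {malg k[E]})@_a *: mono a.
Proof. by rewrite {1}[f]monalgE; apply: eq_bigr => a _; rewrite scale_mono. Qed.

(** Here [chi] is any function, as [malg_eval_lin] requires; for a [monoid_char] this becomes a ring
    morphism. *)
Definition malg_eval (chi : E -> k) f : k :=
  \sum_(a <- msupp (f : {malg k[E]})) (f : {malg k[E]})@_a * chi a.

Lemma malg_evalE chi f : malg_eval chi f = mmap idfun chi f.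
Proof. by []. Qed.

Record monoid_char := MonoidChar {
  char_fun :> E -> k;
  monoid_char0 : char_fun 0 = 1;
  monoid_charD : forall a b, char_fun (a + b) = char_fun a * char_fun b }.

Variable chi : monoid_char.

Lemma malg_evalU (x : k) a : malg_eval chi << x *g a >> = x * chi a.
Proof. by rewrite malg_evalE (mmapU (f := idfun)). Qed.

Lemma malg_eval_additive : zmod_morphism (malg_eval chi).
Proof. exact: (@mmap_is_additive E k k idfun chi). Qed.

HB.instance Definition _ :=
  GRing.isZmodMorphism.Build (monoid_alg k E) k (malg_eval chi) malg_eval_additive.

Lemma malg_eval_multiplicative : monoid_morphism (malg_eval chi).
Proof.
split=> [|f g]; first by rewrite -[1]mono0 malg_evalU mul1r monoid_char0.
rewrite [f * g]/(ma_mul f g) raddf_sum /= [malg_eval chi f]/malg_eval mulr_suml.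
apply: eq_bigr => a _; rewrite raddf_sum /= mulr_sumr.
by apply: eq_bigr => b _; rewrite malg_evalU monoid_charD mulrACA.
Qed.

HB.instance Definition _ := GRing.isMonoidMorphism.Build (monoid_alg k E) k
  (malg_eval chi) malg_eval_multiplicative.

Lemma malg_evalZ (x : k) f : malg_eval chi (x *: f) = x * malg_eval chi f.
Proof.
rewrite -mulr_algl rmorphM /=; congr (_ * _).
by rewrite -mono0 scale_mono malg_evalU monoid_char0 mulr1.
Qed.

Lemma malg_eval_lin (s : {linear monoid_alg k E -> monoid_alg k E}) f :
  malg_eval chi (s f) = malg_eval (fun a => malg_eval chi (s (mono a))) f.
Proof.
rewrite {1}[f]malg_sum !raddf_sum /=; apply: eq_bigr => a _.
by rewrite linearZ malg_evalZ.
Qed.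

End MonoidAlgEval.

Arguments mono k {E} a.

Section RowHom.
Variables (R : comUnitRingType) (n : nat) (h : 'rV[int]_n -> R).
Hypotheses (h0 : h 0 = 1) (hD : forall a b, h (a + b) = h a * h b).

Lemma row_homV m : h m * h (- m) = 1.
Proof. by rewrite -hD subrr. Qed.

Lemma row_hom_unit m : h m \is a GRing.unit.
Proof. by apply/unitrPr; exists (h (- m)); apply: row_homV. Qed.

Lemma row_homZ (a : int) m : h (a *: m) = h m ^ a.
Proof.
have nat_case (j : nat) : h (j%:Z *: m) = h m ^+ j.
  elim: j => [|j IH]; first by rewrite scale0r h0.
  by rewrite intS scalerDl scale1r hD IH exprS.
case: a => j; first exact: nat_case.
by rewrite NegzE scaleNr -invr_expz -[LHS](mulr1_eq (row_homV _)) nat_case.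
Qed.

Lemma row_homE m : h m = \prod_i h (delta_mx 0 i) ^ m 0 i.
Proof.
rewrite {1}[m]row_sum_delta (big_morph h hD h0); apply: eq_bigr => i _.
exact: row_homZ.
Qed.

End RowHom.

(** * Condition (ii) from collinear exponents *)

Section Condition2.
Variables (k : closedFieldType) (n : nat) (p : 'I_n -> k) (T : comUnitAlgType k).
Variables (h : 'rV[int]_n -> T) (S : seq 'rV[int]_n) (c : 'rV[int]_n -> {poly k}).
Hypotheses (p_neq0 : forall i, p i != 0).
Hypotheses (h0 : h 0 = 1) (hD : forall a b, h (a + b) = h a * h b).
Hypothesis no_common_zero : forall (i : nat) b x, (0 < i)%N ->
  (forall j, x j != 0) -> sum_at S c b x = 0 ->
  sum_at S c (b + i%:R) (fun j => p j ^+ i * x j) != 0.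
Hypothesis c_size : forall m, m \in S -> size (c m) = 1%N.
Variables (m0 e : 'rV[int]_n) (l : 'rV[int]_n -> int).
Hypothesis S_line : forall m, m \in S -> m = m0 + l m *: e.

Let L (a : k) : k := \sum_(m <- S) (c m).[0] * a ^ l m.

Lemma c_const m : m \in S -> c m = ((c m).[0])%:P.
Proof. by move=> /c_size/eqP/size_poly1P[a _ ->]; rewrite hornerC. Qed.

Lemma sum_at_line b x : (forall j, x j != 0) ->
  sum_at S c b x = monom_at x m0 * L (monom_at x e).
Proof.
move=> x0; rewrite mulr_sumr /sum_at big_seq [RHS]big_seq; apply: eq_bigr => m mS.
rewrite {2}(S_line mS) (c_const mS) !hornerC monom_atD // mulrCA; congr (_ * (_ * _)).
exact: monom_atZ.
Qed.

(** Extracting a root in a coordinate where [e] is nonzero gives a torus point [x] with [x^e = a],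
    to which [no_common_zero] applies. If [e] were 0, the two values compared would coincide. *)
Lemma no_ratio a (i : nat) : (0 < i)%N -> a != 0 -> monom_at p e ^+ i * a != a ->
  L a = 0 -> L (monom_at p e ^+ i * a) != 0.
Proof.
move=> i0 a0 ae La.
have [j ej] : exists j, e 0 j != 0.
  apply: contrapT => /forallNP H; case/eqP: ae.
  rewrite (_ : monom_at p e = 1) ?expr1n ?mul1r //; apply: big1 => j _.
  by have /negP := H j; rewrite negbK => /eqP ->; rewrite expr0z.
have [y y0 ye] := exists_expz_root ej a0.
pose x := fun j' => if j' == j then y else 1.
have x0 j' : x j' != 0 by rewrite /x; case: ifP; rewrite ?oner_neq0.
have xe : monom_at x e = a.
  rewrite /monom_at (bigD1 j) //= big1 => [|j' /negbTE j'j].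
    by rewrite /x eqxx mulr1.
  by rewrite /x j'j exp1rz.
have px0 j' : p j' ^+ i * x j' != 0 by rewrite mulf_neq0 ?expf_neq0.
have := no_common_zero (b := 0) i0 x0; rewrite !sum_at_line // xe La mulr0 => /(_ erefl).
by rewrite mulf_eq0 negb_or !monom_atMl !monom_atX xe => /andP[].
Qed.

Lemma conditionII_of_line : exists2 u : T, u \is a GRing.unit &
  conditionII (fun i => h (delta_mx 0 i)) p (u * \sum_(m <- S) (c m).[0] *: h m).
Proof.
(* The unit [x^(-m0)] moves the exponents onto the multiples of [e]. *)
exists (h (- m0)); first exact: row_hom_unit.
exists (fun i => e 0 i); rewrite /= -row_homE // -[\prod_(i < n) p i ^ _]/(monom_at p e).
pose g : laurent1 k := \sum_(m <- S) << (c m).[0] *g l m >>.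
exists g; split.
  rewrite laurent_eval_sum mulr_sumr big_seq [RHS]big_seq; apply: eq_bigr => m mS.
  by rewrite -scalerAr -hD {2}(S_line mS) addKr row_homZ //= mulr_algl.
have evL a : laurent_eval idfun a g = L a by rewrite laurent_eval_sum.
move=> a b a0 b0; rewrite !evL => La Lb ab m; apply/negP => /eqP abm.
have aE : a = monom_at p e ^ m * b by rewrite -abm divfK.
(* For a negative exponent the roles of [a] and [b] are exchanged. *)
case: m aE {abm} => i aE.
  case: i aE => [|i] aE; first by rewrite aE expr0z mul1r eqxx in ab.
  have := @no_ratio b i.+1 isT b0 _ Lb; rewrite [_ ^+ _ * b](esym aE) La eqxx.
  by move=> /(_ ab).
have bE : b = monom_at p e ^+ i.+1 * a.
  by rewrite aE NegzE -invr_expz mulVKf // expf_neq0 // monom_at_neq0.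
have := @no_ratio a i.+1 isT a0 _ La; rewrite -bE Lb eqxx eq_sym.
by move=> /(_ ab).
Qed.

End Condition2.

(** * The two types *)

Section Converse.
Variables (k : closedFieldType) (n : nat) (p : 'I_n -> k).
Hypotheses (p_neq0 : forall i, p i != 0) (p_free : freely_generate p).

(** Since [x1] is sent to [x1 + i] by the [i]-th iterate, a common root of [G] and its shift gives
    two roots differing by [i], distinct in characteristic 0. *)
Lemma lonely_of_conditionI (A : comAlgType k) (s : {lrmorphism A -> A}) (x1 u f : A) :
  [pchar k] =i pred0 -> s x1 = x1 + 1 -> u * f != 0 -> conditionI x1 (u * f) ->
  lonely (spec_map s) (vanishing_set f).
Proof.
move=> ch0 sx1 uf0 [G [ufE G_roots]].
have G0 : G != 0 by apply: contraNneq uf0 => G0; rewrite ufE G0 rmorph0.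
apply: (lonely_of_coprime (L := fun i => 'X + i%:R%:P) ufE) => i.
  rewrite rmorphD /= horner_algX horner_algC -[_%:A]/(in_alg A i%:R) rmorph_nat.
  by elim: i => [|i IH]; rewrite ?addr0 // iterS IH rmorphD rmorph_nat /= sx1 -addrA nat1r.
move=> i0; apply: coprimep_no_common_root; first by rewrite G0.
move=> b Gb; apply/negP; rewrite /root horner_comp !hornerE => Gbi.
have bi : b + i%:R != b.
  by rewrite -subr_eq0 addrAC subrr add0r ((pcharf0P k).1 ch0) -lt0n.
by have := G_roots _ _ Gbi Gb bi i%:Z; rewrite addrAC subrr add0r -pmulrn eqxx.
Qed.

Lemma lonely_of_conditionII (A : comUnitAlgType k) (s : {lrmorphism A -> A})
    (x : 'I_n -> A) (u f : A) :
  (forall i, x i \is a GRing.unit) -> (forall i, s (x i) = p i *: x i) ->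
  u \is a GRing.unit -> f != 0 -> f \isn't a GRing.unit ->
  conditionII x p (u * f) -> lonely (spec_map s) (vanishing_set f).
Proof.
move=> ux sx uu f0 fU [e /= [g [ufE g_roots]]].
set z := \prod_(i < n) x i ^ e i in ufE; set rho := \prod_(i < n) p i ^ e i in g_roots.
have uz : z \is a GRing.unit by apply: rpred_prod => i _; apply: unitrXz.
have sz : s z = rho *: z.
  rewrite rmorph_prod /= -mulr_algl -[rho%:A]/(in_alg A rho) rmorph_prod -big_split /=.
  apply: eq_bigr => i _; rewrite rmorphXz //= sx -[p i *: x i]mulr_algl exprMz_comm //; last first.
  - exact: mulrC.
  - by rewrite -[_%:A]/(in_alg A (p i)) rmorph_unit ?unitfE.
  by rewrite -[(p i)%:A]/(in_alg A (p i)) -rmorphXz ?unitfE.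
have uf0 : u * f != 0 by apply: contraNneq f0 => uf0; rewrite -[f](mulKr uu) uf0 mulr0.
have g0 : g != 0.
  by apply: contraNneq uf0 => g0; rewrite ufE g0 /laurent_eval msupp0 big_seq_fset0.
have [d [G [G0 gG]]] := laurent_eval_poly g0.
have gk a : a != 0 -> root G a -> laurent_eval idfun a g = 0.
  by move=> a0 /rootP Ga; rewrite gG ?unitfE // map_poly_id // Ga mulr0.
have fE : z ^ (- d) * u * f = horner_alg z G.
  by rewrite -mulrA ufE gG // mulrA -exprzDr // addNr expr0z mul1r.
(* If [rho] were a root of unity, freeness would give [e = 0] and [z = 1], making [u * f] a nonzero
   constant and [f] a unit. *)
have rho1 (i : nat) : (0 < i)%N -> rho ^+ i != 1.
  move=> i0; apply: contraNneq fU => rhoi.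
  have e0 j : e j = 0.
    have := @p_free (fun j => e j * i%:Z) _ j; rewrite -[RHS]rhoi /rho -prodrXl => H.
    have /eqP := H (eq_bigr _ (fun j _ => esym (exprz_exp (p j) (e j) i))).
    by rewrite mulf_eq0 eqz_nat (gtn_eqF i0) orbF => /eqP.
  have z1 : z = 1 by apply: big1 => j _; rewrite e0 expr0z.
  move: fE; rewrite z1 exp1rz mul1r => fE.
  have uG : in_alg A G.[1] = u * f by rewrite fE -(horner_map (in_alg A)) rmorph1.
  have G1 : G.[1] \is a GRing.unit.
    by rewrite unitfE; apply: contraNneq uf0 => G1; rewrite -uG G1 rmorph0.
  by rewrite -(unitrMr _ uu) -uG rmorph_unit.
apply: (lonely_of_coprime (L := fun i => rho ^+ i *: 'X) fE) => i.
  rewrite linearZ /= horner_algX mulr_algl; elim: i => [|i IH]; first by rewrite expr0 scale1r.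
  by rewrite iterS IH linearZ /= sz scalerA -exprSr.
have G_neq0 : G != 0 by apply: contraNneq G0 => ->; rewrite root0.
move=> i0; apply: coprimep_no_common_root; first by rewrite G_neq0.
move=> a Ga; apply/negP; rewrite /root horner_comp hornerZ hornerX => Gra.
have a0 : a != 0 by apply: contraTneq Ga => ->.
have rho0 : rho != 0 by apply/prodf_neq0 => j _; apply: expfz_neq0.
have ra0 : rho ^+ i * a != 0 by rewrite mulf_neq0 ?expf_neq0.
have := g_roots _ _ ra0 a0 (gk _ ra0 Gra) (gk _ a0 Ga) _ i%:Z.
rewrite mulfK // exprnP eqxx => H; have /H// : rho ^+ i * a != a.
by rewrite -subr_eq0 -[X in _ - X]mul1r -mulrBl mulf_neq0 // subr_eq0 rho1.
Qed.

End Converse.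

(** * Type B: from loneliness to condition (ii) *)

Section TypeB.
Variables (k : closedFieldType) (n : nat) (p : 'I_n -> k).
Hypotheses (p_neq0 : forall i, p i != 0) (p_free : freely_generate p).
Variable s : {lrmorphism ringB k n -> ringB k n}.
Hypothesis s_var : forall i, s (varB k i) = p i *: varB k i.

Definition charB x (x0 : forall i, x i != 0) : monoid_char k 'rV[int]_n :=
  MonoidChar (monom_at0 (k := k) x) (fun a b => monom_atD a b x0).

Definition evalB (x : 'I_n -> k) : ringB k n -> k := malg_eval (monom_at x).

(** One application of [s] before evaluation multiplies the point by [p]. Both sides are
    multiplicative on monomials, so variables suffice. *)
Lemma evalB_iter x f (i : nat) : (forall j, x j != 0) ->
  evalB x (iter i s f) = evalB (fun j => p j ^+ i * x j) f.
Proof.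
move=> x0; elim: i f => [|i IH] f.
  by congr evalB; apply/funext => j; rewrite expr0 mul1r.
rewrite iterSr IH; have px0 j : p j ^+ i * x j != 0 by rewrite mulf_neq0 ?expf_neq0.
rewrite /evalB -[monom_at _]/(charB px0 : _ -> _) malg_eval_lin.
congr malg_eval; apply/funext => m.
pose h m := malg_eval (charB px0) (s (mono k m)).
rewrite -[LHS]/(h m) (row_homE (h := h)) /h.
- apply: eq_bigr => j _; rewrite -[mono k _]/(varB k j) s_var malg_evalZ.
  by rewrite [malg_eval _ _]malg_evalU /= mul1r monom_at_delta mulrA exprS.
- by rewrite mono0 !rmorph1.
- by move=> a b; rewrite monoD !rmorphM.
Qed.

Lemma typeB_converse (f : ringB k n) :
  f != 0 -> f \isn't a GRing.unit -> lonely (spec_map s) (vanishing_set f) ->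
  exists2 u, u \is a GRing.unit & conditionII (varB k (n := n)) p (u * f).
Proof.
move=> f0 fU /lonelyP f_lonely.
pose S : seq 'rV[int]_n := msupp (f : {malg k[_]}).
pose c m := ((f : {malg k[_]})@_m)%:P.
have sumE b x : sum_at S c b x = evalB x f.
  by apply: eq_bigr => m _; rewrite hornerC.
have disj (i : nat) b x : (0 < i)%N -> (forall j, x j != 0) -> sum_at S c b x = 0 ->
    sum_at S c (b + i%:R) (fun j => p j ^+ i * x j) != 0.
  move=> i0 x0; rewrite !sumE -evalB_iter // => /eqP fx.
  exact: (f_lonely i (kernel_spec (malg_eval (charB x0))) i0 fx).
have US : uniq S by apply: fset_uniq.
have fE : f = \sum_(m <- S) (c m).[0] *: mono k m.
  by rewrite {1}[f]malg_sum; apply: eq_bigr => m _; rewrite hornerC.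
have hD := @monoD k 'rV[int]_n.
(* With a single exponent [f] would be a nonzero scalar times a monomial, a unit. *)
have S2 : (1 < size S)%N.
  rewrite ltnNge; apply: contra fU => S1; have [m Sm] : exists m, S = [:: m].
    case ES : S S1 => [|m [|//]] _; last by exists m.
    by move/eqP: f0; rewrite fE ES big_nil.
  have cm : (f : {malg k[_]})@_m != 0.
    have mS : m \in S by rewrite Sm mem_head.
    by rewrite mcoeff_neq0.
  rewrite fE Sm big_seq1 hornerC -mulr_algl unitrM (row_hom_unit (mono0 k _) hD) andbT.
  by rewrite -[_%:A]/(in_alg (ringB k n) _) rmorph_unit ?unitfE.
have c0 m : m \in S -> c m != 0 by move=> mS; rewrite polyC_eq0 mcoeff_neq0.
have cz m : false || (size (c m) <= 1)%N by rewrite size_polyC leq_b1.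
have z0 : false -> [pchar k] =i pred0 by [].
have [c1 [m0 [e [l Hl]]]] := support_on_line p_neq0 p_free z0 US c0 cz disj S2.
have [u uu Hu] := conditionII_of_line p_neq0 (mono0 k _) hD disj c1 Hl.
rewrite -fE in Hu.
exists u; [exact: uu | exact: Hu].
Qed.

End TypeB.

(** * Type A: from loneliness to condition (i) or (ii) *)

Section TypeA.
Variables (k : closedFieldType) (n : nat) (p : 'I_n -> k).
Hypotheses (p_neq0 : forall i, p i != 0) (p_free : freely_generate p).
Hypothesis k_char0 : [pchar k] =i pred0.
Variable s : {lrmorphism ringA k n -> ringA k n}.
Hypothesis s_var1 : s (varA1 k n) = varA1 k n + 1.
Hypothesis s_var : forall i, s (varA k i) = p i *: varA k i.

Local Notation E := (nat * 'rV[int]_n)%type.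

Definition monomA (b : k) (x : 'I_n -> k) (a : E) : k := b ^+ a.1 * monom_at x a.2.

Lemma monomA0 b x : monomA b x 0 = 1.
Proof. by rewrite /monomA expr0 mul1r monom_at0. Qed.

Lemma monomAD b x : (forall i, x i != 0) ->
  forall a a', monomA b x (a + a') = monomA b x a * monomA b x a'.
Proof. by move=> x0 a a'; rewrite /monomA exprD monom_atD // mulrACA. Qed.

Definition charA b x (x0 : forall i, x i != 0) : monoid_char k E :=
  MonoidChar (monomA0 b x) (monomAD b x0).

Definition evalA b x : ringA k n -> k := malg_eval (monomA b x).

Definition rowA m : ringA k n := mono k ((0%N, m) : E).

Lemma rowA0 : rowA 0 = 1. Proof. by []. Qed.

Lemma rowAD m m' : rowA (m + m') = rowA m * rowA m'.
Proof. by rewrite -[RHS]monoD. Qed.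

Lemma mono_varA1 j : mono k ((j, 0) : E) = varA1 k n ^+ j.
Proof.
elim: j => [|j IH]; first by rewrite expr0.
by rewrite exprS -IH -[RHS]monoD; congr (mono k (_, _)); rewrite addr0.
Qed.

Lemma monoA (a : E) : mono k a = varA1 k n ^+ a.1 * rowA a.2.
Proof.
rewrite -mono_varA1 -[RHS]monoD; congr (mono k _); case: a => j m.
by congr (_, _); rewrite /= ?addr0 ?add0r.
Qed.

Lemma evalA_iter b x f (i : nat) : (forall j, x j != 0) ->
  evalA b x (iter i s f) = evalA (b + i%:R) (fun j => p j ^+ i * x j) f.
Proof.
move=> x0; elim: i f => [|i IH] f.
  rewrite addr0; congr evalA; apply/funext => j; by rewrite expr0 mul1r.
rewrite iterSr IH; have px0 j : p j ^+ i * x j != 0 by rewrite mulf_neq0 ?expf_neq0.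
rewrite /evalA -[monomA _ _]/(charA (b + i%:R) px0 : _ -> _) malg_eval_lin.
congr malg_eval; apply/funext => a; set chi := charA _ _.
have sE : s (mono k a) = (varA1 k n + 1) ^+ a.1 * s (rowA a.2).
  rewrite monoA rmorphM rmorphXn; exact: (congr1 (fun y => y ^+ a.1 * s (rowA a.2)) s_var1).
have chi1 : malg_eval chi (varA1 k n) = b + i%:R.
  by rewrite [LHS]malg_evalU mul1r /= /monomA expr1 monom_at0 mulr1.
rewrite -[LHS]/(malg_eval chi (s (mono k a))) sE rmorphM rmorphXn rmorphD.
rewrite rmorph1 /= chi1 -addrA natr1; congr (_ * _).
pose h m := malg_eval chi (s (rowA m)).
rewrite -[LHS]/(h a.2) (row_homE (h := h)) /h.
- apply: eq_bigr => j _; rewrite -[rowA _]/(varA k j) s_var malg_evalZ.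
  by rewrite [malg_eval _ _]malg_evalU /= mul1r /monomA expr0 mul1r monom_at_delta mulrA exprS.
- by rewrite rowA0 !rmorph1.
- by move=> m m'; rewrite rowAD !rmorphM.
Qed.

Lemma typeA_converse (f : ringA k n) :
  f != 0 -> lonely (spec_map s) (vanishing_set f) ->
  exists2 u, u \is a GRing.unit &
    conditionI (varA1 k n) (u * f) \/ conditionII (varA k (n := n)) p (u * f).
Proof.
move=> f0 /lonelyP f_lonely.
pose r : seq E := msupp (f : {malg k[_]}).
pose S : seq 'rV[int]_n := undup (map snd r).
(* Collects the powers of [x_1] that stand in front of [x^m]. *)
pose c m : {poly k} := \sum_(a <- r | a.2 == m) (f : {malg k[_]})@_a *: 'X^(a.1).
have sumE b x : sum_at S c b x = evalA b x f.
  rewrite /sum_at /evalA /malg_eval -(big_undup_fibers snd); apply: eq_bigr => m _.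
  rewrite horner_sum mulr_suml; apply: eq_bigr => a /eqP <-.
  by rewrite hornerZ hornerXn mulrA.
have disj (i : nat) b x : (0 < i)%N -> (forall j, x j != 0) -> sum_at S c b x = 0 ->
    sum_at S c (b + i%:R) (fun j => p j ^+ i * x j) != 0.
  move=> i0 x0; rewrite !sumE -evalA_iter // => /eqP fx.
  exact: (f_lonely i (kernel_spec (malg_eval (charA b x0))) i0 fx).
have US : uniq S by apply: undup_uniq.
have fE : f = \sum_(m <- S) horner_alg (varA1 k n) (c m) * rowA m.
  rewrite {1}[f]malg_sum -(big_undup_fibers snd); apply: eq_bigr => m _.
  rewrite rmorph_sum mulr_suml /=; apply: eq_bigr => a /eqP <-.
  by rewrite linearZ rmorphXn /= horner_algX monoA scalerAl mulr_algl.
have c0 m : m \in S -> c m != 0.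
  rewrite mem_undup => /mapP[a ar ->]; have fa : (f : {malg k[_]})@_a != 0.
    by rewrite mcoeff_neq0.
  apply: contraNneq fa => cm0; have <- : (c a.2)`_a.1 = (f : {malg k[_]})@_a.
    rewrite coef_sum big_mkcond (bigD1_seq a) ?fset_uniq //= eqxx coefZ coefXn eqxx.
    rewrite mulr1 big_seq_cond big1 ?addr0 // => a' /andP[_ aa']; case: eqP => // a2.
    rewrite coefZ coefXn; case: eqP => [a1|_]; last by rewrite mulr0.
    by case/eqP: aa'; rewrite [a']surjective_pairing a2 -a1 -surjective_pairing.
  by rewrite cm0 coef0.
(* A single exponent makes [f] a unit times a polynomial in [x_1], which leads to (i); several
   exponents lead to (ii). *)
have [S1|S2] := leqP (size S) 1.
  have [m Sm] : exists m, S = [:: m].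
    case ES : S S1 => [|m [|//]] _; last by exists m.
    by move/eqP: f0; rewrite fE ES big_nil.
  exists (rowA (- m)); first exact: (row_hom_unit rowA0 rowAD).
  left; exists (c m); split.
    by rewrite [in LHS]fE Sm big_seq1 mulrC -mulrA -rowAD subrr mulr1.
  have no_diff b (i : nat) : (0 < i)%N -> root (c m) b -> ~~ root (c m) (b + i%:R).
    move=> i0 rb; have x0 (j : 'I_n) : (1 : k) != 0 by apply: oner_neq0.
    have := disj i b (fun=> 1) i0 x0; rewrite /sum_at Sm !big_seq1 (rootP rb) mul0r.
    by move=> /(_ erefl); rewrite mulf_eq0 negb_or => /andP[].
  (* A negative difference is reversed by exchanging [a] and [b]. *)
  move=> a b ra rb ab [] i; apply/negP => /eqP abi.
    case: i abi => [|i] abi; first by rewrite -subr_eq0 abi eqxx in ab.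
    have := no_diff b i.+1 isT rb; rewrite pmulrn -abi addrC subrK ra //.
  have := no_diff a i.+1 isT ra; rewrite (_ : a + _ = b) ?rb //.
  by rewrite -[a](subrK b) abi NegzE mulrNz -pmulrn addrAC addNr add0r.
have z0 : true -> [pchar k] =i pred0 by [].
have cz m : true || (size (c m) <= 1)%N by [].
have [c1 [m0 [e [l Hl]]]] := support_on_line p_neq0 p_free z0 US c0 cz disj S2.
have [u uu Hu] := conditionII_of_line p_neq0 rowA0 rowAD disj c1 Hl.
exists u => //; right; move: Hu; congr (conditionII _ _ (u * _)).
rewrite [RHS]fE big_seq [RHS]big_seq; apply: eq_bigr => m mS.
by rewrite [in RHS](c_const c1 mS) horner_algC mulr_algl.
Qed.

End TypeA.

(** * Assembly of the two equivalences *)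

Theorem theorem6p1 (k : closedFieldType) (n : nat) (p : 'I_n -> k)
    (p_neq0 : forall i, p i != 0) (p_free : freely_generate p) :
  ([pchar k] =i pred0 ->
    forall sigma : {lrmorphism ringA k n -> ringA k n},
      bijective sigma ->
      sigma (varA1 k n) = varA1 k n + 1 ->
      (forall i, sigma (varA k i) = p i *: varA k i) ->
    forall f : ringA k n, f != 0 -> f \isn't a GRing.unit ->
      lonely (spec_map sigma) (vanishing_set f) <->
      exists2 u : ringA k n, u \is a GRing.unit &
        conditionI (varA1 k n) (u * f) \/ conditionII (varA k (n := n)) p (u * f))
  /\
  (forall sigma : {lrmorphism ringB k n -> ringB k n},
      bijective sigma ->
      (forall i, sigma (varB k i) = p i *: varB k i) ->
    forall f : ringB k n, f != 0 -> f \isn't a GRing.unit ->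
      lonely (spec_map sigma) (vanishing_set f) <->
      exists2 u : ringB k n, u \is a GRing.unit &
        conditionII (varB k (n := n)) p (u * f)).
Proof.
have uf0 (T : comUnitRingType) (u f : T) : u \is a GRing.unit -> f != 0 -> u * f != 0.
  by move=> uu; apply: contraNneq => uf; rewrite -[f](mulKr uu) uf mulr0.
split=> [k_char0|] sigma _ => [s_var1|] s_var f f0 fU.
  split=> [f_lonely|[u uu [fI|fII]]].
  - exact: (typeA_converse p_neq0 p_free k_char0 s_var1 s_var f0 f_lonely).
  - exact: (lonely_of_conditionI k_char0 s_var1 (uf0 _ _ _ uu f0) fI).
  - apply: (lonely_of_conditionII p_neq0 p_free _ s_var uu f0 fU fII) => i.
    exact: (row_hom_unit (rowA0 k n) (@rowAD k n)).
split=> [f_lonely|[u uu fII]].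
  exact: (typeB_converse p_neq0 p_free s_var f0 fU f_lonely).
apply: (lonely_of_conditionII p_neq0 p_free _ s_var uu f0 fU fII) => i.
exact: (row_hom_unit (mono0 k _) (@monoD k _)).
Qed.
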